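(* Let $V_{SRPT}$ be the steady-state sojourn time of a customer in a stable $GI/GI/1$ queue with light-tailed service times under the preemptive shortest remaining processing time discipline. Let $x_B=\sup\{x:\mathbb{P}\{B>x\}>0\}\in(0,\infty]$ be the right endpoint of the service-time distribution, and suppose that $\mathbb{P}\{B=x_B\}=0$ (which holds in particular if $x_B=\infty$). Then, as $x\to\infty$, $\log\mathbb{P}\{V_{SRPT}>x\}\sim-\gamma_p x$, i.e. $\lim_{x\to\infty}\frac1x\log\mathbb{P}\{V_{SRPT}>x\}=-\gamma_p$, where $$\gamma_p=\sup_{s\ge 0}\{s-\Psi(s)\},\qquad \Psi(s)=-\Phi_A^{-1}\!\left(\frac{1}{\Phi_B(s)}\right).$$
   Context: Queue: single server working at unit speed; i.i.d. inter-arrival times distributed as $A\ge0$ and, independently, i.i.d. service times distributed as $B\ge 0$. Standing assumptions: $\rho=\mathbb{E}\{B\}/\mathbb{E}\{A\}<1$; $\mathbb{P}\{B>A\}>0$ for independent $A,B$; $B$ is light-tailed, i.e. $\mathbb{E}\{e^{sB}\}<\infty$ for $s$ in a neighborhood of $0$. The queue is in steady state. Notation: $\Phi_X(s)=\mathbb{E}\{e^{sX}\}$. $\Phi_A$ restricted to $(-\infty,0]$ is strictly increasing with range $(\mathbb{P}\{A=0\},1]$, and $\Phi_A^{-1}$ is its inverse; conventions: $1/\infty=0$ and $\Phi_A^{-1}(u)=-\infty$ for $0\le u\le\mathbb{P}\{A=0\}$ (so $\Psi(s)=+\infty$ there). Preemptive SRPT: at every time the server works on a customer with the smallest remaining service time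 among those present, interrupting (and later resuming without loss) the customer in service if needed; ties are broken in order of arrival. The sojourn time of a customer is the time between arrival and service completion. *)

(* Defs.v *)
From HB Require Import structures.
From mathcomp Require Import all_boot all_order all_algebra.
From mathcomp Require Import all_classical all_reals all_analysis.

Set Implicit Arguments.
Unset Strict Implicit.
Unset Printing Implicit Defensive.

Import Order.TTheory GRing.Theory Num.Theory.
Import numFieldNormedType.Exports.

Local Open Scope classical_set_scope.
Local Open Scope ring_scope.

Section Probability.
Context {d : measure_display} {T : measurableType d} {R : realType}.
Variable P : probability T R.

Definition mutually_independent (I : choiceType) (X : I -> {RV P >-> R}) : Prop :=
  forall (J : seq I) (E : I -> set R), uniq J ->
    (forall i, measurable (E i)) ->
    P [set w | forall i, i \in J -> E i (X i w)] =
    (\prod_(i <- J) P (X i @^-1` E i))%E.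

Definition same_law (X Y : {RV P >-> R}) : Prop :=
  forall E : set R, measurable E -> distribution P X E = distribution P Y E.

Definition light_tailed (X : {RV P >-> R}) : Prop :=
  exists2 s0 : R, 0 < s0 & forall s : R, `|s| < s0 -> ('M_P X s < +oo)%E.

Definition right_endpoint (X : {RV P >-> R}) : \bar R :=
  ereal_sup [set x%:E | x in [set x : R | (0 < P [set w | (x < X w)%R])%E]].

Definition mgf_inv (A : {RV P >-> R}) (u : \bar R) : \bar R :=
  if (u <= P [set w | A w = 0%R])%E then -oo%E
  else ('pinv_(fun=> 0) [set y : R | y <= 0] ('M_P A) u)%:E.

(* In [\bar R], [inve] maps [+oo] to [0]. *)
Definition Psi (A B : {RV P >-> R}) (s : R) : \bar R :=
  (- mgf_inv A ('M_P B s)^-1)%E.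

Definition gamma_p (A B : {RV P >-> R}) : \bar R :=
  ereal_sup [set (s%:E - Psi A B s)%E | s in [set s : R | 0 <= s]].

End Probability.

(* Sample-path dynamics. Customers are numbered [0, 1, 2, ...] in order of
   arrival; [a n] is the time between the arrivals of customers [n] and [n.+1],
   [b n] is the service time of customer [n], and [r n u] is the remaining
   service time of customer [n] at time [u]. *)
Section SamplePath.
Context {R : realType}.
Variables (a b : nat -> R) (r : nat -> R -> R).

Definition arrival_time (n : nat) : R := \sum_(i < n) a i.

Definition present (n : nat) (u : R) : Prop :=
  arrival_time n <= u /\ 0 < r n u.

Definition has_priority (n : nat) (u : R) : Prop :=
  present n u /\
  forall m, present m u -> r n u < r m u \/ (r n u = r m u /\ (n <= m)%N).

(* The customer selected at time [u] is served at unit speed on a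
   nondegenerate interval [u, u + e[, not just at the instant [u]: with
   almost-everywhere rates instead, the rule for ties would have no force,
   because serving either of two tied customers breaks the tie at once in
   favour of that customer. *)
Record preemptive_srpt : Prop := {
  srpt_before : forall n u, u <= arrival_time n -> r n u = b n;
  srpt_continuous : forall n, continuous (r n);
  srpt_served : forall n u, has_priority n u ->
    \forall v \near u^'+, r n v = r n u - (v - u);
  srpt_waits : forall n u, ~ has_priority n u ->
    \forall v \near u^'+, r n v = r n u }.

Definition sojourn_time (n : nat) : \bar R :=
  ereal_inf [set (u - arrival_time n)%:E |
             u in [set u : R | arrival_time n <= u /\ r n u = 0]].

End SamplePath.

Definition converges_in_law {d d' : measure_display} {T : measurableType d}
    {T' : measurableType d'} {R : realType} (P : probability T R)
    (Q : probability T' R) (X : nat -> {RV P >-> R}) (Y : {RV Q >-> R}) : Prop :=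
  forall x : R, {for x, continuous (cdf Y)} ->
    cdf (X n) x @[n --> \oo] --> cdf Y x.

(* Main.v *)
(* Upper bound. A customer staying longer than x sees a server that is busy
   without interruption from the start of the current busy period until x time
   units after the arrival. A Chernoff bound with parameters s for the services
   and psi in (Psi(s), s) for the interarrival times, summed over the customer
   that starts the busy period and over the last arrival, gives
   P(V_n > x) <= C e^{-(s - psi) x} uniformly in n.

   Lower bound. A customer larger than some level b below the right endpoint is
   not served as long as the customers smaller than b keep the server busy. So
   let theta > gamma_p; then E e^{theta A + s (B - A)} > 1 for all s >= 0, and by
   compactness this survives rounding (A up, B down) on a fine dyadic grid and
   the truncation of B at a level b that services exceed with positive
   probability. For the resulting finite walk with jumps z and clock a, one finds
   s and a small w > 0 with E e^{theta a + s z} sin(w z) = 0 and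
   E e^{theta a + s z} cos(w z) > 1; the function e^{s y} sin(w y), truncated to
   [0, pi / w], is then a subsolution for the killed walk, which yields
   P(the walk stays nonnegative until the clock exceeds x) >= c e^{-theta x}. *)
Require Import Defs.
From HB Require Import structures.
From mathcomp Require Import all_boot all_order all_algebra.
From mathcomp Require Import all_classical all_reals all_analysis.
From mathcomp Require Import measurable_realfun.
From mathcomp Require Import ring lra.

Set Implicit Arguments.
Unset Strict Implicit.
Unset Printing Implicit Defensive.

Import Order.TTheory GRing.Theory Num.Theory.
Import numFieldNormedType.Exports.

Local Open Scope classical_set_scope.
Local Open Scope ring_scope.

(** * Sample paths of the SRPT queue *)

(** That $\theta>\gamma_p$ pushes the tilted expectation above 1 is the definition of [Psi] undone:
    it says $s-\theta<\Psi(s)$, i.e. $\Phi_A(\theta-s)\Phi_B(s)>1$. Either factor may be infinite;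
    on a finite grid the expectation becomes a finite sum, smooth in $s$. The sine is what remains
    of a complex tilt: $e^{sy}\sin(wy)$ is the imaginary part of $e^{(s+iw)y}$ and, unlike a real
    exponential, vanishes at 0, where the walk is killed, and is negative just below. The truncation
    level has to meet two opposite demands: services above it keep positive probability, so that the
    tagged customer can be one of them, while the mass it removes is negligible in the limit. The
    hypothesis $\mathbb{P}\{B=x_B\}=0$ reconciles them. The constants in both tail bounds depend
    neither on the customer (from some index on, for the lower bound) nor on $x$; the bounds
    therefore pass to the limit in law, and avoiding the discontinuity points of the limit costs
    only a bounded factor. *)

Lemma interval_induction (R : realType) (C : set R) (p q : R) :
  closed C -> p <= q -> C p ->
  (forall u, p <= u -> u < q -> C u -> \forall v \near u^'+, C v) -> C q.
Proof.
move=> clC pq Cp step.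
pose S := [set t | p <= t <= q /\ C t].
have S0 : S !=set0 by exists p; split; rewrite ?lexx.
have Sub : has_ubound S by exists q => t [/andP[]].
have hS : has_sup S by split.
have CS : closed S.
  have -> : S = `[p, q]%classic `&` C.
    by apply/seteqP; split => t /=; rewrite in_itv.
  by apply: closedI => //; exact: interval_closed.
have := closure_sup S0 Sub; rewrite -(closure_id _).1// => -[/andP[ps sq] Cs].
have [<-//|sneq] := eqVneq (sup S) q.
have {sneq}sltq : sup S < q by rewrite lt_neqAle sneq.
have [v [vs vq Cv]] : exists v, [/\ sup S < v, v <= q & C v].
  near (sup S)^'+ => v.
  exists v; split; [by near: v; exact: nbhs_right_gt| |near: v].
    by near: v; apply: nbhs_right_ltW.
  exact: step.
have : v <= sup S.
  by apply: ub_le_sup => //; split => //; rewrite vq andbT (le_trans ps (ltW vs)).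
by rewrite leNgt vs.
Unshelve. all: by end_near. Qed.

(** [preemptive_srpt] describes the path only on a right neighbourhood, of unspecified length, of
    each instant. Continuous induction turns this into statements on whole intervals without
    counting the switches of the server. *)
Lemma right_decreasing_le (R : realType) (g : R -> R) (p q : R) :
  continuous g -> p <= q ->
  (forall u, p <= u -> u < q -> \forall v \near u^'+, g v <= g u) ->
  g q <= g p.
Proof.
move=> cg pq step.
apply: (@interval_induction R [set t | g t <= g p] p q) => //=.
- by apply: (@closed_comp _ _ g [set y | y <= g p]) => // ? ?; exact: cg.
- move=> u pu uq gu; have := step u pu uq; apply: filterS => v gv.
  exact: le_trans gv gu.
Qed.

Section Arrivals.
Context {R : realType}.
Variable a : nat -> R.
Hypothesis a_ge0 : forall n, 0 <= a n.

Lemma arrival_timeS n : arrival_time a n.+1 = arrival_time a n + a n.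
Proof. by rewrite /arrival_time big_ord_recr. Qed.

Lemma arrival_time_le m n : (m <= n)%N -> arrival_time a m <= arrival_time a n.
Proof.
move=> /subnK <-; elim: (n - m)%N => [//|k IH].
by rewrite addSn arrival_timeS (le_trans IH)// lerDl.
Qed.

Lemma arrival_time_sub k n : (k <= n)%N ->
  arrival_time a n - arrival_time a k = \sum_(k <= i < n) a i.
Proof.
move=> kn; rewrite /arrival_time -!(big_mkord xpredT a)/=.
by rewrite (@big_cat_nat _ _ _ k)//= addrAC subrr add0r.
Qed.

Lemma arrival_index k n u : (k <= n)%N ->
  arrival_time a k <= u -> u < arrival_time a n ->
  exists j, [/\ (k <= j)%N, (j < n)%N, arrival_time a j <= u
    & u < arrival_time a j.+1].
Proof.
move=> /subnK <-; elim: (n - k)%N => [|l IH].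
  by rewrite add0n => ku; rewrite ltNge ku.
move=> ku ul; have [ll|ll] := ltP u (arrival_time a (l + k)).
  have [j [kj jl ? ?]] := IH ku ll; exists j; split => //.
  by rewrite addSn ltnS ltnW.
by exists (l + k)%N; split => //; exact: leq_addl.
Qed.

End Arrivals.

(** * Work conservation and priorities along a single path *)

Section Paths.
Context {R : realType}.
Variables (a b : nat -> R) (r : nat -> R -> R).
Hypothesis a_ge0 : forall n, 0 <= a n.
Hypothesis b_ge0 : forall n, 0 <= b n.
Hypothesis srpt : preemptive_srpt a b r.

Local Notation t := (arrival_time a).
Local Notation priority := (has_priority a r).

Lemma has_priority_inj m n u : priority m u -> priority n u -> m = n.
Proof.
move=> [pm hm] [pn hn].
case: (hm _ pn) => [lt1|[eq1 le1]]; case: (hn _ pm) => [lt2|[eq2 le2]].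
- by have := lt_trans lt1 lt2; rewrite ltxx.
- by move: lt1; rewrite eq2 ltxx.
- by move: lt2; rewrite eq1 ltxx.
- by apply/eqP; rewrite eqn_leq le1.
Qed.

Lemma remaining_ge0 n u : 0 <= r n u.
Proof.
have [un|nu] := leP u (t n); first by rewrite (srpt_before srpt).
apply: (@interval_induction R [set v | 0 <= r n v] (t n) u) => //.
- apply: (@closed_comp _ _ (r n) [set y | 0 <= y]) => [? _|].
    exact: (srpt_continuous srpt).
  exact: closed_ge.
- exact: ltW.
- by rewrite /= (srpt_before srpt).
move=> v _ _ /= rv; case: (pselect (priority n v)) => [pv|npv].
- have := srpt_served srpt pv; have [[_ rv0] _] := pv => H.
  near=> w; rewrite /= (near H w)// subr_ge0.
  by apply: ltW; near: w; exact: nbhs_right_ltDr.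
- by have := srpt_waits srpt npv; apply: filterS => w /= ->.
Unshelve. all: by end_near. Qed.

Lemma remaining_near i u : \forall v \near u^'+,
  r i v = r i u - (if `[< priority i u >] then v - u else 0).
Proof.
case: asboolP => [pi|npi]; first exact: (srpt_served srpt).
by have := srpt_waits srpt npi; apply: filterS => v ->; rewrite subr0.
Qed.

Lemma remaining_le i u v : u <= v -> r i v <= r i u.
Proof.
move=> uv; apply: right_decreasing_le => // [w|w _ _].
  exact: (srpt_continuous srpt).
near=> z; rewrite (near (remaining_near i w) z)//.
rewrite gerBl; case: ifP => // _; rewrite subr_ge0 ltW//.
Unshelve. all: by end_near. Qed.

Lemma remaining_le_service i u : r i u <= b i.
Proof.
have [ut|/ltW tu] := leP u (t i); first by rewrite (srpt_before srpt).
by rewrite (le_trans (remaining_le i tu))// (srpt_before srpt).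
Qed.

(** The bound [N] guarantees a minimiser, which need not exist among infinitely many customers. In
    the induction the new customer [n] replaces the current choice only if strictly smaller, as the
    rule for ties demands. *)
Lemma has_priority_exists N u : (forall i, present a r i u -> (i < N)%N) ->
  (exists i, present a r i u) -> exists i, priority i u.
Proof.
move=> hN [i0 pi0].
suff: exists i, (i < N)%N /\ present a r i u /\
    forall m, (m < N)%N -> present a r m u ->
      r i u < r m u \/ (r i u = r m u /\ (i <= m)%N).
  by move=> [i [iN [pi hi]]]; exists i; split => // m pm; apply: hi => //; exact: hN.
have : exists2 i, (i < N)%N & present a r i u by exists i0 => //; exact: hN.
elim: (N) => [[]//|n IH] [i iN pi].
have [[i1 i1n pi1]|no] := pselect (exists2 i, (i < n)%N & present a r i u).
  have [j [jn [pj hj]]] : exists i, (i < n)%N /\ present a r i u /\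
    forall m, (m < n)%N -> present a r m u ->
      r i u < r m u \/ (r i u = r m u /\ (i <= m)%N) by apply: IH; exists i1.
  have [[pn rnj]|npn] := pselect (present a r n u /\ r n u < r j u).
    exists n; split => //; split => // m; rewrite ltnS leq_eqVlt => /predU1P[->|mn] pm.
      by right.
    by left; case: (hj m mn pm) => [/(lt_trans rnj)//|[<-]].
  exists j; split; first exact: leqW.
  split => // m; rewrite ltnS leq_eqVlt => /predU1P[->|mn] pm; last exact: hj.
  have : r j u <= r n u by rewrite leNgt; apply/negP => ?; apply: npn.
  by rewrite le_eqVlt => /predU1P[->|]; [right; split => //; exact: ltnW|left].
have ein : i = n.
  move: iN; rewrite ltnS leq_eqVlt => /predU1P[//|ilt].
  by exfalso; apply: no; exists i.
exists n; rewrite -ein; split => //; split => // m.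
rewrite ein ltnS leq_eqVlt => /predU1P[->|mn] pm; first by right.
by exfalso; apply: no; exists m.
Qed.

(** Customers yet to arrive count with their full service time, by [srpt_before]. Arrivals thus
    cause no jumps and the quantity is continuous in [u]. *)
Definition total_remaining (N : nat) (p : pred nat) (u : R) : R :=
  \sum_(i < N | p i) r i u.

Lemma total_remaining_continuous N (p : pred nat) : continuous (total_remaining N p).
Proof.
apply: continuous_big => [z|i _]; first exact: add_continuous.
exact: (srpt_continuous srpt).
Qed.

Lemma total_remaining_near N (p : pred nat) u : \forall v \near u^'+,
  total_remaining N p v = total_remaining N p u -
    \sum_(i < N | p i) (if `[< priority i u >] then v - u else 0).
Proof.
have H : \forall v \near u^'+, forall i : 'I_N,
    r i v = r i u - (if `[< priority i u >] then v - u else 0).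
  by apply: filter_forall => i; exact: remaining_near.
near=> v; rewrite /total_remaining -sumrB; apply: eq_bigr => i _.
by rewrite (near H v).
Unshelve. all: by end_near. Qed.

Lemma total_remaining_busy N (p : pred nat) i u : (i < N)%N -> p i -> priority i u ->
  \forall v \near u^'+, total_remaining N p v = total_remaining N p u - (v - u).
Proof.
move=> iN pi hi; have := total_remaining_near N p u.
apply: filterS => v ->; congr (_ - _).
rewrite (bigD1 (Ordinal iN))//= asboolT// big1 ?addr0// => j /andP[_ ji].
rewrite asboolF// => hj; move/eqP: ji; apply; apply: val_inj => /=.
exact: has_priority_inj hj hi.
Qed.

Lemma total_remaining_near_ge N (p : pred nat) u :
  \forall v \near u^'+, total_remaining N p u - (v - u) <= total_remaining N p v.
Proof.
have [[i iN [pi hi]]|no] :=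
    pselect (exists2 i, (i < N)%N & p i /\ priority i u).
  by have := total_remaining_busy iN pi hi; apply: filterS => v ->.
near=> v; rewrite (near (total_remaining_near N p u) v)//.
rewrite [X in _ <= _ - X]big1 ?subr0; last first.
  by move=> i pi; rewrite asboolF// => hi; apply: no; exists i.
rewrite gerBl subr_ge0 ltW//.
Unshelve. all: by end_near. Qed.

(** Priority is unique, so at most one customer of the class [p] is served at a time, at unit speed:
    the sum of work and time cannot decrease. *)
Lemma total_remaining_ge N (p : pred nat) u v : u <= v ->
  total_remaining N p u - (v - u) <= total_remaining N p v.
Proof.
move=> uv.
suff : - (total_remaining N p v + v) <= - (total_remaining N p u + u) by lra.
apply: (@right_decreasing_le _ (fun w => - (total_remaining N p w + w))) => //.
  move=> w; apply: cvgN; apply: cvgD; [exact: total_remaining_continuous|exact: cvg_id].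
by move=> w _ _; have := total_remaining_near_ge N p w; apply: filterS => z; lra.
Qed.

Lemma total_remaining_busy_eq N u v : u <= v ->
  (forall w, u <= w -> w < v -> exists2 i, (i < N)%N & priority i w) ->
  total_remaining N xpredT v = total_remaining N xpredT u - (v - u).
Proof.
move=> uv busy; apply/le_anti; rewrite total_remaining_ge// andbT.
suff : total_remaining N xpredT v + v <= total_remaining N xpredT u + u by lra.
apply: (@right_decreasing_le _ (fun w => total_remaining N xpredT w + w)) => //.
  move=> w; apply: cvgD; [exact: total_remaining_continuous|exact: cvg_id].
move=> w uw wv; have [i iN pi] := busy w uw wv.
have := @total_remaining_busy N xpredT i w iN isT pi; apply: filterS => z; lra.
Qed.

(* [k] is the customer who starts the busy period in progress at time [t n + x]. *)
Lemma busy_period_work n m (x : R) : (n <= m)%N -> 0 <= x ->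
  t m <= t n + x -> t n + x < t m.+1 ->
  (forall u, t n <= u -> u <= t n + x -> r n u != 0) ->
  exists2 k, (k <= n)%N & x + (t n - t k) <= \sum_(k <= i < m.+1) b i.
Proof.
move=> nm x0 tmx xtm busy.
(* [k] is the last index up to [n] whose arrival finds all earlier customers finished; index 0
   qualifies vacuously. By maximality every later arrival up to [n] finds unfinished work. *)
have [k kn [idle kmax]] : exists2 k, (k <= n)%N &
    (forall i, (i < k)%N -> r i (t k) = 0) /\
    forall l, (k < l)%N -> (l <= n)%N -> exists2 i, (i < l)%N & r i (t l) != 0.
  have [] := @ex_maxnP (fun k => (k <= n)%N && [forall i : 'I_k, r i (t k) == 0]) n.
  - by exists 0%N; apply/forallP => -[].
  - by move=> l /andP[].
  move=> k /andP[kn /forallP hk] kmax; exists k => //; split.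
    by move=> i ik; apply/eqP; exact: hk (Ordinal ik).
  move=> l kl ln; apply: contrapT => no.
  have : (l <= k)%N; last by rewrite leqNgt kl.
  apply: kmax; rewrite ln/=; apply/forallP => i.
  by apply: contrapT => /negP ri; apply: no; exists i.
have tkn : t k <= t n by exact: arrival_time_le.
exists k => //.
have present_lt i w : w < t m.+1 -> present a r i w -> (i < m.+1)%N.
  move=> wm [tiw _]; rewrite ltnNge; apply/negP => /(arrival_time_le a_ge0).
  by rewrite leNgt (le_lt_trans tiw wm).
(* Before [t n], the work found by the next arrival was already there at time [w], because remaining
   times never increase; from [t n] on, customer [n] is present. *)
have some_present w : t k <= w -> w <= t n + x -> exists i, present a r i w.
  move=> kw wx; have [nw|wn] := leP (t n) w.
    by exists n; split => //; rewrite lt0r remaining_ge0 busy.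
  have [l [kl ln lw wl]] := arrival_index kn kw wn.
  have [i il ri] := kmax l.+1 kl ln.
  exists i; split; first by apply: le_trans lw; exact: arrival_time_le.
  rewrite lt0r remaining_ge0 andbT; apply/eqP => ri0.
  by move: ri; rewrite eq_le remaining_ge0 andbT -ri0 remaining_le// ltW.
have kx : t k <= t n + x by rewrite (le_trans tkn)// lerDl.
have E : total_remaining m.+1 xpredT (t n + x) =
    total_remaining m.+1 xpredT (t k) - (t n + x - t k).
  apply: total_remaining_busy_eq => // w kw wx.
  have wm : w < t m.+1 by rewrite (lt_trans wx).
  have [i hi] := @has_priority_exists m.+1 w (fun i => @present_lt i w wm)
    (some_present w kw (ltW wx)).
  by exists i => //; apply: present_lt hi.1.
have T0 : 0 <= total_remaining m.+1 xpredT (t n + x).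
  by apply: sumr_ge0 => i _; exact: remaining_ge0.
(* At [t k] the customers before [k] contribute nothing and those from [k] to [m] everything; the
   bound is then nonnegativity of the work left at [t n + x]. *)
have Tk : total_remaining m.+1 xpredT (t k) = \sum_(k <= i < m.+1) b i.
  rewrite /total_remaining -(big_mkord xpredT (fun i => r i (t k))).
  rewrite (@big_cat_nat _ _ _ k)//=; last by rewrite leqW// (leq_trans kn).
  rewrite big_nat big1 ?add0r; last by move=> i /andP[_ ik]; exact: idle.
  apply: eq_big_nat => i /andP[ki _].
  by rewrite (srpt_before srpt)// arrival_time_le.
by move: T0; rewrite E Tk; lra.
Qed.

(* If customer [n] were served, the smaller customers [h, ..., j] (without [n])
   would all have left, although the work they brought exceeds the time elapsed
   since the arrival of [h]. *)
Lemma tagged_not_served h n N (y : R) : (h <= n)%N -> (n < N)%N ->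
  (forall i, (h <= i < N)%N -> i != n -> b i < y) -> y <= b n ->
  (forall j, (n <= j < N)%N ->
     t j.+1 - t h <= \sum_(h <= i < j.+1 | i != n) b i) ->
  forall u, t n <= u -> u <= t N -> r n u = b n.
Proof.
move=> hn nN small yn work u nu uN.
have ub : r n (t n) = b n by rewrite (srpt_before srpt).
apply: (@interval_induction R [set v | r n v = b n] (t n) u) => //.
  apply: (@closed_comp _ _ (r n) [set y | y = b n]) => [? _|].
    exact: (srpt_continuous srpt).
  exact: closed_eq.
move=> v nv vu /= rv.
have [pv|npv] := pselect (priority n v); last first.
  by have := srpt_waits srpt npv; apply: filterS => w /= ->.
exfalso.
have vN : v < t N by exact: lt_le_trans vu uN.
have [j [nj jN jv vj]] := arrival_index (ltnW nN) nv vN.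
have hjN : (h <= j.+1 <= N)%N by rewrite jN leqW// (leq_trans hn).
pose p i := (h <= i)%N && (i != n).
have hv : t h <= v by rewrite (le_trans _ nv)// arrival_time_le.
have := @total_remaining_ge N p (t h) v hv.
have -> : total_remaining N p (t h) = \sum_(h <= i < N | i != n) b i.
  rewrite /total_remaining big_geq_mkord/=; apply: eq_big => i.
    by rewrite /p andbC.
  by move=> /andP[hi _]; rewrite (srpt_before srpt)// arrival_time_le.
(* An unfinished member of the class who has arrived would be smaller than [r n v = b n], against
   the priority of [n]. Hence only the indices above [j] contribute. *)
have -> : total_remaining N p v = \sum_(j.+1 <= i < N | i != n) b i.
  rewrite /total_remaining big_geq_mkord/= big_mkcond [RHS]big_mkcond/=.
  apply: eq_bigr => i _; rewrite /p.
  have [ji|ij] := ltnP j i.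
    rewrite (leq_trans hn (leq_trans nj (ltnW ji)))/= andbT.
    case: ifP => // _; rewrite (srpt_before srpt)//.
    by rewrite (le_trans (ltW vj))// arrival_time_le.
  rewrite andbF; case: ifP => // /andP[hi inn].
  apply/eqP; rewrite eq_le remaining_ge0 andbT leNgt; apply/negP => ri.
  have pi : present a r i v.
    by split => //; rewrite (le_trans _ jv)// arrival_time_le.
  have ry : r i v < r n v.
    rewrite rv (le_lt_trans (remaining_le_service i v))//.
    by rewrite (lt_le_trans _ yn)// small// hi ltn_ord.
  by case: (pv.2 _ pi) => [/(lt_trans ry)|[E _]]; [|move: ry; rewrite E]; rewrite ltxx.
(* The work of [h], ..., [j] has been done by time [v], so it is at most [v - t h], which is
   strictly less than [t j.+1 - t h]; this contradicts [work]. *)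
rewrite (@big_cat_nat _ _ _ j.+1 h N) /=; [|by case/andP: hjN..].
have : t j.+1 - t h <= \sum_(h <= i < j.+1 | i != n) b i by apply: work; rewrite nj.
lra.
Qed.

End Paths.

Section SojournPaths.
Context {R : realType}.
Variables (a b : nat -> R) (r : nat -> R -> R).
Local Notation t := (arrival_time a).

Lemma sojourn_time_gt n (x : R) : (x%:E < sojourn_time a r n)%E ->
  forall u, t n <= u -> u <= t n + x -> r n u != 0.
Proof.
move=> xs u nu ux; apply: contraTneq xs => ru; rewrite -leNgt.
apply: (@le_trans _ _ (u - t n)%:E); last by rewrite lee_fin lerBlDl.
by apply: ereal_inf_lbound; exists u.
Qed.

Lemma sojourn_time_ge n (v : R) :
  (forall u, t n <= u -> u < v -> r n u != 0) ->
  ((v - t n)%:E <= sojourn_time a r n)%E.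
Proof.
move=> H; apply: le_ereal_inf_tmp => _ [u [nu ru] <-].
rewrite lee_fin lerB// leNgt; apply/negP => uv.
by have := H u nu uv; rewrite ru eqxx.
Qed.

End SojournPaths.

(** * Survival of a finite walk with a clock *)

Section TrigonometricBounds.
Context {R : realType}.
Implicit Types x : R.

Let ge0_of_derive (f df : R -> R) x : 0 <= x -> f 0 = 0 ->
  (forall y : R, is_derive y 1 f (df y)) -> (forall y, 0 <= y -> 0 <= df y) ->
  0 <= f x.
Proof.
move=> x0 f0 fdf df0.
have cf : {within `[0, x], continuous f}.
  by apply: derivable_within_continuous => y _; exact: (@ex_derive _ _ _ _ _ _ _ (fdf y)).
have [c] := @MVT_segment R f df 0 x x0 (fun y _ => fdf y) cf.
rewrite in_itv/= f0 !subr0 => /andP[c0 _] ->.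
by rewrite mulr_ge0// df0.
Qed.

Lemma sin_le x : 0 <= x -> sin x <= x.
Proof.
move=> x0; rewrite -subr_ge0.
apply: (@ge0_of_derive (fun y => y - sin y) (fun y => 1 - cos y)) => //.
by rewrite sin0 subrr.
Qed.

Lemma cos_ge x : 1 - x ^+ 2 / 2 <= cos x.
Proof.
wlog x0 : x / 0 <= x => [H|].
  have [/H//|x0] := leP 0 x.
  by rewrite -sqrrN -cosN H// oppr_ge0 ltW.
rewrite -subr_ge0.
apply: (@ge0_of_derive (fun y => cos y - (1 - y ^+ 2 / 2)) (fun y => y - sin y)) => //.
- by rewrite cos0 expr0n/= mul0r subr0 subrr.
- move=> y; apply: is_derive_eq.
  rewrite /GRing.scale/=; lra.
- by move=> y y0; rewrite subr_ge0 sin_le.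
Qed.

Lemma sin_ge x : 0 <= x -> x - x ^+ 3 / 6 <= sin x.
Proof.
move=> x0; rewrite -subr_ge0.
apply: (@ge0_of_derive (fun y => sin y - (y - y ^+ 3 / 6))
  (fun y => cos y - (1 - y ^+ 2 / 2))) => //.
- by rewrite sin0 expr0n/= mul0r subr0 subrr.
- move=> y; apply: is_derive_eq.
  rewrite /GRing.scale/=; lra.
- by move=> y y0; rewrite subr_ge0 cos_ge.
Qed.

Lemma sin_near x : `|sin x - x| <= `|x| ^+ 3.
Proof.
wlog x0 : x / 0 <= x => [H|].
  have [/H//|x0] := leP 0 x.
  by have := H (- x); rewrite sinN -opprD !normrN; apply; rewrite oppr_ge0 ltW.
have x3 : 0 <= x ^+ 3 by exact: exprn_ge0.
rewrite (ger0_norm x0) ler0_norm; last by rewrite subr_le0 sin_le.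
by have := sin_ge x0; lra.
Qed.

End TrigonometricBounds.

(** * A subsolution for the killed walk *)

Section Survival.
Context {R : realType} {I : finType}.
Variables (w a z : I -> R) (theta : R).

(* Mass of the [k]-step paths of the walk with step weights [w] and increments
   [z], started at [y], that stay nonnegative until the clock (which advances
   by [a]) exceeds [x]. *)
Fixpoint survival (k : nat) (x y : R) : R :=
  if y < 0 then 0 else if x < 0 then 1 else
  if k is k'.+1 then \sum_i w i * survival k' (x - a i) (y + z i) else 0.

Hypothesis w_ge0 : forall i, 0 <= w i.
Hypothesis w_le1 : \sum_i w i <= 1.
Hypothesis a_ge0 : forall i, 0 <= a i.
Hypothesis theta_gt0 : 0 < theta.

Definition tilted_weight s i : R := w i * expR (theta * a i + s * z i).

Lemma tilted_weight_ge0 s i : 0 <= tilted_weight s i.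
Proof. by rewrite mulr_ge0 ?expR_ge0. Qed.

Lemma survival_ge0 k x y : 0 <= survival k x y.
Proof.
elim: k x y => [|k IH] x y /=; case: ifP => // _; case: ifP => // _.
by apply: sumr_ge0 => i _; rewrite mulr_ge0.
Qed.

Lemma tilted_sum_continuous (h : I -> R) :
  continuous (fun s => \sum_i tilted_weight s i * h i).
Proof.
apply: continuous_big => [y|i _ s]; first exact: add_continuous.
apply: cvgM; last exact: cvg_cst.
apply: cvgM; first exact: cvg_cst.
apply: continuous_comp; last exact: continuous_expR.
apply: cvgD; first exact: cvg_cst.
by apply: cvgM; [exact: cvg_id|exact: cvg_cst].
Qed.

Section Potential.
Variables (s om : R).
Hypotheses (s_ge0 : 0 <= s) (om_gt0 : 0 < om).
Hypothesis z_small : forall i, om * `|z i| <= pi.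
Hypothesis sin_sum : \sum_i tilted_weight s i * sin (om * z i) = 0.
Let kappa := \sum_i tilted_weight s i * cos (om * z i).
Hypothesis kappa_gt1 : 1 < kappa.

(* The jumps being at most [pi / om] in size, the truncation only replaces
   nonpositive values of [sin] by [0]: this is why [phi] is a subsolution. *)
Let phi y := if (0 <= y) && (om * y <= pi) then expR (s * y) * sin (om * y) else 0.
Let M := expR (s * (pi / om)).

Let phi_ge0 y : 0 <= phi y.
Proof.
rewrite /phi; case: ifP => // /andP[y0 yp].
by rewrite mulr_ge0 ?expR_ge0// sin_ge0_pi// yp andbT mulr_ge0// ltW.
Qed.

Let phi_neg y : y < 0 -> phi y = 0.
Proof. by move=> y0; rewrite /phi [0 <= y]leNgt y0. Qed.

Let phi_le y : phi y <= M.
Proof.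
rewrite /phi; case: ifP => [/andP[y0 yp]|_]; last exact: expR_ge0.
rewrite -[M]mulr1 ler_pM ?expR_ge0 ?sin_le1//.
  by rewrite sin_ge0_pi// yp andbT mulr_ge0// ltW.
by rewrite ler_expR ler_wpM2l// ler_pdivlMr// mulrC.
Qed.

Let phi_ge y : - pi <= om * y -> om * y <= pi *+ 2 ->
  expR (s * y) * sin (om * y) <= phi y.
Proof.
move=> yl yu; rewrite /phi; case: ifPn => //.
rewrite negb_and -!ltNge => /orP[y0|y1]; rewrite mulr_ge0_le0 ?expR_ge0//.
  rewrite -oppr_ge0 -sinN sin_ge0_pi// oppr_ge0 lerNl yl andbT.
  by rewrite mulr_ge0_le0 ?ltW.
rewrite -[om * y](subrK pi) sinDpi oppr_le0 sin_ge0_pi// subr_ge0 (ltW y1)/=.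
by rewrite lerBlDr -mulr2n.
Qed.

(** Without truncation this is an equality: averaging $e^{(s+i\omega)y}$ over a tilted step
    multiplies it by a complex number whose imaginary part is [sin_sum], hence zero, and whose real
    part is [kappa]. Truncation only raises the right-hand side. *)
Let phi_subsolution y :
  kappa * phi y <= \sum_i w i * expR (theta * a i) * phi (y + z i).
Proof.
rewrite {1}/phi; case: ifPn => [/andP[y0 yp]|_]; last first.
  by rewrite mulr0 sumr_ge0// => i _; rewrite !mulr_ge0 ?expR_ge0.
have oy0 : 0 <= om * y by rewrite mulr_ge0// ltW.
have -> : kappa * (expR (s * y) * sin (om * y)) =
   \sum_i w i * expR (theta * a i) * (expR (s * (y + z i)) * sin (om * (y + z i))).
  transitivity (expR (s * y) * (sin (om * y) * kappa +
      cos (om * y) * \sum_i tilted_weight s i * sin (om * z i))).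
    by rewrite sin_sum mulr0 addr0; ring.
  rewrite /kappa !mulr_sumr -big_split/= mulr_sumr; apply: eq_bigr => i _.
  rewrite /tilted_weight !mulrDr sinD !expRD; ring.
apply: ler_sum => i _; rewrite ler_wpM2l ?mulr_ge0 ?expR_ge0//.
have := z_small i; rewrite -{1}(gtr0_norm om_gt0) -normrM ler_norml => /andP[z1 z2].
by apply: phi_ge; rewrite mulrDr ?mulr2n; lra.
Qed.

Let amax := \sum_i a i.

Let a_le i : a i <= amax.
Proof. by rewrite /amax (bigD1 i)//= lerDl sumr_ge0. Qed.

(** The normalisation that makes the bound at most 1 on success: the clock overshoots by at most
    [amax], so there $e^{-\theta x}\phi(y)\le e^{\theta\,\mathrm{amax}}M$. *)
Let c0 := expR (- theta * amax) / M.

(** The term [M / kappa ^+ k] pays for the paths still undecided after [k] steps. It makes the case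
    of no steps trivial, and each step wins a factor [kappa] from the subsolution, while the total
    weight of a step is at most 1. *)
Let survival_ge k x y : - amax <= x ->
  c0 * (expR (- theta * x) * phi y - M / kappa ^+ k) <= survival k x y.
Proof.
have M0 : 0 < M by exact: expR_gt0.
have c00 : 0 <= c0 by rewrite mulr_ge0 ?expR_ge0// invr_ge0 ltW.
have k0 : 0 < kappa by rewrite (lt_trans ltr01).
have Mk l : 0 < M / kappa ^+ l by rewrite divr_gt0// exprn_gt0.
have trivial_bound l x' y' : expR (- theta * x') * phi y' <= M / kappa ^+ l ->
    c0 * (expR (- theta * x') * phi y' - M / kappa ^+ l) <= survival l x' y'.
  move=> H; apply: le_trans (survival_ge0 _ _ _).
  by rewrite mulr_ge0_le0// subr_le0.
have negative_clock l x' y' : - amax <= x' -> x' < 0 ->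
    c0 * (expR (- theta * x') * phi y' - M / kappa ^+ l) <= survival l x' y'.
  move=> xa x0; have [y0|y0] := ltP y' 0.
    by apply: trivial_bound; rewrite phi_neg// mulr0 ltW.
  have -> : survival l x' y' = 1 by case: l => [|l]/=; rewrite ltNge y0/= x0.
  have : c0 * (expR (- theta * x') * phi y') <= 1.
    apply: (@le_trans _ _ (c0 * (expR (theta * amax) * M))).
      rewrite ler_wpM2l// ler_pM ?expR_ge0// ler_expR mulNr -mulrN.
      by rewrite ler_pM2l// lerNl.
    rewrite /c0 mulNr expRN.
    have -> : (expR (theta * amax))^-1 / M * (expR (theta * amax) * M) = 1.
      by field; rewrite !gt_eqF ?expR_gt0.
    exact: lexx.
  have := mulr_ge0 c00 (ltW (Mk l)); lra.
elim: k x y => [|k IH] x y xa.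
  have [x0|x0] := leP 0 x; last exact: negative_clock.
  apply: trivial_bound; rewrite expr0 divr1 -[M]mul1r ler_pM ?expR_ge0//.
  by rewrite expR_le1 mulr_le0_ge0// oppr_le0 ltW.
have [y0|y0] := ltP y 0.
  by apply: trivial_bound; rewrite phi_neg// mulr0 ltW.
have [x0|x0] := ltP x 0; first exact: negative_clock.
(* If the difference is nonpositive there is nothing to prove; if it is positive, the factor
   [kappa > 1] won in this step may be dropped. *)
have [|H] := leP (expR (- theta * x) * phi y) (M / kappa ^+ k.+1).
  exact: trivial_bound.
rewrite /= ltNge y0/= ltNge x0/=.
have S1 : c0 * (kappa * (expR (- theta * x) * phi y - M / kappa ^+ k.+1)) <=
    \sum_i w i * survival k (x - a i) (y + z i).
  apply: (@le_trans _ _ (\sum_i w i * (c0 *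
     (expR (- theta * (x - a i)) * phi (y + z i) - M / kappa ^+ k)))); last first.
    apply: ler_sum => i _; rewrite ler_wpM2l// IH//.
    by have := a_le i; lra.
  have -> : \sum_i w i * (c0 *
     (expR (- theta * (x - a i)) * phi (y + z i) - M / kappa ^+ k)) =
     c0 * (expR (- theta * x) * (\sum_i w i * expR (theta * a i) * phi (y + z i))
       - M / kappa ^+ k * \sum_i w i).
    rewrite !mulr_sumr -sumrB mulr_sumr; apply: eq_bigr => i _.
    have -> : - theta * (x - a i) = - theta * x + theta * a i by ring.
    rewrite expRD; ring.
  rewrite ler_wpM2l// mulrBr lerB//.
    by rewrite mulrCA ler_wpM2l ?expR_ge0.
  have -> : kappa * (M / kappa ^+ k.+1) = M / kappa ^+ k.
    rewrite exprS invfM mulrCA; congr (_ * _).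
    by rewrite mulrA divff ?mul1r// gt_eqF.
  rewrite -[leRHS]mulr1.
  by rewrite ler_wpM2l// ltW.
apply: le_trans S1; rewrite ler_wpM2l// ler_peMl ?(ltW kappa_gt1)//.
by rewrite subr_ge0 ltW.
Qed.

Lemma survival_lower_bound_potential : exists c y : R, [/\ 0 < c, 0 <= y &
  forall x : R, 0 <= x -> exists k, c * expR (- theta * x) <= survival k x y].
Proof.
have M0 : 0 < M by exact: expR_gt0.
have c00 : 0 < c0 by rewrite divr_gt0// expR_gt0.
(* The midpoint of the support of [phi], where the sine equals 1. *)
pose y0 := pi / 2 / om.
have oy0 : om * y0 = pi / 2 by rewrite /y0 mulrC divfK// gt_eqF.
have phi0 : 0 < phi y0.
  rewrite /phi oy0 ler_piMr ?pi_ge0 ?invf_le1 ?ler1n// sin_pihalf mulr1 andbT.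
  by rewrite divr_ge0 ?ltW// ?divr_gt0 ?pi_gt0// ?expR_gt0.
exists (c0 * (phi y0 / 2)), y0; split.
- by rewrite mulr_gt0// divr_gt0.
- by rewrite !divr_ge0 ?pi_ge0// ltW.
move=> x x0.
have e0 : 0 < expR (- theta * x) * phi y0 / 2 / M by rewrite !divr_gt0// mulr_gt0// expR_gt0.
(* The number of steps depends on [x]: the correction must fall below half of the main term, which
   explains the factor [phi y0 / 2] in the constant. *)
have [k hk] : exists k, kappa^-1 ^+ k < expR (- theta * x) * phi y0 / 2 / M.
  have /cvgrPdist_lt/(_ _ e0) [k _ hk] : (kappa^-1 ^+ k) @[k --> \oo] --> (0 : R).
    apply: cvg_expr; rewrite ger0_norm ?invf_lt1 ?(lt_trans ltr01)//.
    by rewrite invr_ge0 ltW// (lt_trans ltr01).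
  exists k; have := hk k (leqnn k); rewrite /= sub0r normrN ger0_norm//.
  by rewrite exprn_ge0// invr_ge0 ltW// (lt_trans ltr01).
exists k; have xa : - amax <= x by rewrite (le_trans _ x0)// oppr_le0 sumr_ge0.
apply: le_trans (survival_ge k y0 xa).
rewrite -mulrA ler_wpM2l// ?ltW//.
move: hk; rewrite ltr_pdivlMr// exprVn => hk.
have -> : M / kappa ^+ k = (kappa ^+ k)^-1 * M by rewrite mulrC.
by lra.
Qed.

End Potential.

Hypothesis tilted_mass : forall s, 0 <= s -> 1 < \sum_i tilted_weight s i.
Hypothesis drift_lt0 : \sum_i tilted_weight 0 i * z i < 0.

(** For small [om] the sine sum is close to [om] times the tilted drift, which changes sign between
    0 and [s1]; the intermediate value theorem gives a zero [s]. There the cosine sum is close to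
    the tilted mass. Since [s] depends on [om], all error bounds are uniform over [[0, s1]]. *)
Lemma survival_lower_bound s1 : 0 <= s1 ->
  0 < \sum_i tilted_weight s1 i * z i ->
  exists c y : R, [/\ 0 < c, 0 <= y &
  forall x : R, 0 <= x -> exists k, c * expR (- theta * x) <= survival k x y].
Proof.
move=> s10 drift1.
have [smin /[!in_itv]/= /andP[smin0 _] hmin] : exists2 c, c \in `[0, s1]%R &
    forall t, t \in `[0, s1]%R ->
      \sum_i tilted_weight c i * 1 <= \sum_i tilted_weight t i * 1.
  apply: (@EVT_min R (fun s => \sum_i tilted_weight s i * 1) 0 s1 s10).
  by apply: continuous_subspaceT; exact: tilted_sum_continuous.
have := tilted_mass smin0; set m := \sum_i _ => m1.
have mle s : 0 <= s -> s <= s1 -> m <= \sum_i tilted_weight s i.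
  move=> s0 s1'; have := hmin s; rewrite in_itv/= s0 s1' => /(_ isT).
  by under eq_bigr do rewrite mulr1; under [leRHS]eq_bigr do rewrite mulr1.
(* A majorant of the tilted weights for every parameter in [[0, s1]]. *)
pose W i := w i * expR (theta * a i + s1 * `|z i|).
have W0 i : 0 <= W i by rewrite mulr_ge0 ?expR_ge0.
have tW s i : 0 <= s -> s <= s1 -> tilted_weight s i <= W i.
  move=> s0 ss; rewrite ler_wpM2l// ler_expR lerD2l.
  rewrite (@le_trans _ _ (s * `|z i|))//; first by rewrite ler_wpM2l// ler_norm.
  by rewrite ler_wpM2r.
pose K2 := \sum_i W i * `|z i| ^+ 2; pose K3 := \sum_i W i * `|z i| ^+ 3.
pose Z := \sum_i `|z i|.
have K20 : 0 <= K2 by apply: sumr_ge0 => i _; rewrite mulr_ge0// exprn_ge0.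
have K30 : 0 <= K3 by apply: sumr_ge0 => i _; rewrite mulr_ge0// exprn_ge0.
have Z0 : 0 <= Z by apply: sumr_ge0.
have small K e : 0 <= K -> 0 < e -> \forall om \near (0 : R)^'+, om * K < e.
  move=> K0 e0; near=> om.
  have : om * (K + 1) < e.
    rewrite -ltr_pdivlMr ?ltr_wpDl//; near: om; apply: nbhs_right_lt.
    by rewrite divr_gt0// ltr_wpDl.
  have : 0 < om by [].
  rewrite mulrDr; lra.
(* In turn: [om < 1] absorbs surplus powers of [om], [om * Z < pi] is the restriction on the jumps,
   [om * K2 < m - 1] keeps the cosine sum above 1, and the last two keep the signs of the drifts. *)
have [om [om0 om1 omZ om2 [om30 om31]]] : exists om : R, [/\ 0 < om, om < 1,
    om * Z < pi,
    om * K2 < m - 1 &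
    om * K3 < - \sum_i tilted_weight 0 i * z i /\
    om * K3 < \sum_i tilted_weight s1 i * z i].
  near (0 : R)^'+ => om; exists om; (do ?split) ; near: om.
  - exact: nbhs_right_gt.
  - exact: nbhs_right_lt.
  - by apply: small => //; exact: pi_gt0.
  - by apply: small => //; rewrite subr_gt0.
  - by apply: small => //; rewrite oppr_gt0.
  - exact: small.
have sin_err s : 0 <= s -> s <= s1 ->
   `|\sum_i tilted_weight s i * sin (om * z i) -
     om * \sum_i tilted_weight s i * z i| <= om * (om * K3).
  move=> s0 ss; rewrite mulr_sumr -sumrB (le_trans (ler_norm_sum _ _ _))//.
  rewrite /K3 !mulr_sumr; apply: ler_sum => i _.
  rewrite mulrCA -mulrBr normrM ger0_norm ?tilted_weight_ge0//.
  rewrite mulrA (mulrCA _ (W i)) ler_pM ?tilted_weight_ge0 ?tW//.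
  rewrite (le_trans (sin_near _))// normrM gtr0_norm// exprMn ler_wpM2r ?exprn_ge0//.
  have -> : om ^+ 3 = om * om * om by ring.
  by rewrite ler_piMr ?mulr_ge0 ?ltW.
have [s] : exists2 s, s \in `[0, s1] &
    \sum_i tilted_weight s i * sin (om * z i) = 0.
  apply: (@IVT R (fun s => \sum_i tilted_weight s i * sin (om * z i))) => //.
    by apply: continuous_subspaceT; exact: tilted_sum_continuous.
  have := sin_err 0 (lexx 0) s10; have := sin_err s1 s10 (lexx s1).
  rewrite !ler_norml => /andP[Hs1 _] /andP[_ Hs0]; move: Hs1 Hs0.
  set S0 := \sum_i tilted_weight 0 i * sin _.
  set S1 := \sum_i tilted_weight s1 i * sin _ => Hs1 Hs0.
  have S0lt : S0 < 0.
    rewrite (@le_lt_trans _ _ (om * (om * K3 + \sum_i tilted_weight 0 i * z i)))//.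
      by rewrite mulrDr; lra.
    by rewrite pmulr_rlt0//; lra.
  have S1gt : 0 < S1.
    rewrite (@lt_le_trans _ _ (om * (\sum_i tilted_weight s1 i * z i - om * K3)))//.
      by rewrite pmulr_rgt0//; lra.
    by rewrite mulrBr; lra.
  by rewrite ge_min le_max (ltW S0lt) (ltW S1gt) orbT.
rewrite in_itv/= => /andP[s0 ss] sin0.
apply: (@survival_lower_bound_potential s om) => //.
- move=> i; rewrite (le_trans _ (ltW omZ))// ler_wpM2l ?(ltW om0)//.
  by rewrite /Z (bigD1 i)//= lerDl sumr_ge0.
have : m - om * K2 <= \sum_i tilted_weight s i * cos (om * z i).
  apply: (@le_trans _ _ (\sum_i tilted_weight s i - om * K2)).
    by rewrite lerB// mle.
  rewrite /K2 mulr_sumr -sumrB; apply: ler_sum => i _.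
  have c1 := cos_ge (om * z i).
  have t0 := tilted_weight_ge0 s i.
  have := ler_wpM2l t0 c1; apply: le_trans.
  rewrite mulrBr mulr1 lerB// [leRHS]mulrCA.
  apply: ler_pM => //; first by rewrite divr_ge0// sqr_ge0.
    exact: tW.
  rewrite exprMn real_normK ?num_real// mulrAC ler_wpM2r ?sqr_ge0//.
  by rewrite expr2; nra.
by move: om2; lra.
Unshelve. all: by end_near. Qed.

End Survival.

(** * Expectations of products of independent variables *)

Section ProductExpectation.
Context {d : measure_display} {T : measurableType d} {R : realType}.
Variable P : probability T R.

Import HBNNSimple.

(** Independence of [X] and [g] is needed only in the form of the hypothesis on sets, with [c] as
    the mean of [g]; simple functions and monotone convergence extend it from indicators to [f]. *)
Lemma integral_mul_of_sets (X : {RV P >-> R}) (g : T -> R) (c : R) :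
  measurable_fun setT g -> (forall w, 0 <= g w) -> 0 <= c ->
  (forall E, measurable E ->
     (\int[P]_(w in X @^-1` E) (g w)%:E = c%:E * P (X @^-1` E))%E) ->
  forall f : R -> R, measurable_fun setT f -> (forall x, 0 <= f x) ->
  (\int[P]_w ((f (X w))%:E * (g w)%:E) = c%:E * \int[P]_w (f (X w))%:E)%E.
Proof.
move=> mg g0 c0 H f mf f0.
have mEg : measurable_fun setT (fun w => (g w)%:E) by exact/measurable_EFinP.
have mEf : measurable_fun setT (fun w => (f w)%:E) by exact/measurable_EFinP.
pose phi n := nnsfun_approx measurableT mEf n.
have mX E : measurable E -> measurable (X @^-1` E).
  by move=> mE; rewrite -[X @^-1` E]setTI; exact: measurable_funP.
have mphiX n : measurable_fun setT (fun w => (phi n (X w))%:E).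
  by apply/measurable_EFinP; apply: measurableT_comp.
have phi_cvg x : (phi n x)%:E @[n --> \oo] --> (f x)%:E.
  by apply: (@cvg_nnsfun_approx _ _ _ setT measurableT _ mEf) => // y _; rewrite lee_fin.
have phi_nd x : nondecreasing_seq (fun n => (phi n x)%:E).
  move=> m n mn; rewrite lee_fin; apply/lefP.
  exact: (@nd_nnsfun_approx _ _ _ setT measurableT _ mEf).
have L n : (\int[P]_w ((phi n (X w))%:E * (g w)%:E) = c%:E * \int[P]_w (phi n (X w))%:E)%E.
  have phiE w : ((phi n (X w))%:E =
      \sum_(y \in range (phi n)) (y * \1_(X @^-1` (phi n @^-1` [set y])) w)%:E)%E.
    by rewrite fimfunE -fsumEFin.
  have y0 (y : R) w : 0 <= y * \1_(X @^-1` (phi n @^-1` [set y])) w.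
    have [yr|yr] := pselect (exists x, phi n x = y).
      by case: yr => x <-; rewrite mulr_ge0.
    rewrite indicE memNset ?mulr0//= => Xy; apply: yr; by exists (X w).
  have mpre y : measurable (X @^-1` (phi n @^-1` [set y])).
    by apply: mX; rewrite -[X in measurable X]setTI; exact: measurable_funP.
  have mind y : measurable_fun setT
      (fun w => (y * \1_(X @^-1` (phi n @^-1` [set y])) w)%:E).
    apply/measurable_EFinP; apply: measurable_funM => //.
  pose u y w : \bar R := (y * \1_(X @^-1` (phi n @^-1` [set y])) w)%:E.
  have -> : (\int[P]_w ((phi n (X w))%:E * (g w)%:E) =
      \int[P]_w \sum_(y \in range (phi n)) (u y w * (g w)%:E))%E.
    by apply: eq_integral => w _; rewrite phiE ge0_mule_fsuml// => y; rewrite lee_fin.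
  have -> : (\int[P]_w (phi n (X w))%:E =
      \int[P]_w \sum_(y \in range (phi n)) u y w)%E.
    by apply: eq_integral => w _; rewrite phiE.
  have u0 y w : (0 <= u y w)%E by rewrite lee_fin.
  have fr : finite_set (range (phi n)) by [].
  rewrite (@ge0_integral_fsum _ _ _ P setT measurableT _ (fun y w => u y w * (g w)%:E)%E _ _ _ fr); last 2 first.
  - by move=> y; apply: emeasurable_funM; [exact: mind|exact: mEg].
  - by move=> y w _; rewrite mule_ge0// lee_fin.
  rewrite (@ge0_integral_fsum _ _ _ P setT measurableT _ u mind _ _ fr)//.
  rewrite ge0_mule_fsumr//; last by move=> y; apply: integral_ge0 => w _; rewrite lee_fin.
  apply: eq_fsbigr => y /[!inE] -[x _ xy].
  have yge0 : 0 <= y by rewrite -xy.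
  transitivity (y%:E * (c%:E * P (X @^-1` (phi n @^-1` [set y]))))%E.
    rewrite -H; last by rewrite -[X in measurable X]setTI; exact: measurable_funP.
    rewrite -ge0_integralZl ?lee_fin//; [|exact: measurable_funTS|by move=> w _; rewrite lee_fin].
    rewrite [RHS]integral_mkcond; apply: eq_integral => w _.
    rewrite patchE /u indicE; case: ifPn => wE; first by rewrite mulr1.
    by rewrite mulr0 mul0e.
  rewrite muleCA; congr (_ * _)%E.
  under eq_integral do rewrite /u EFinM.
  rewrite ge0_integralZl ?lee_fin//; last by apply/measurable_EFinP.
  by rewrite integral_indic// setIT.
have C1 : (\int[P]_w ((phi n (X w))%:E * (g w)%:E))%E @[n --> \oo] -->
    (\int[P]_w ((f (X w))%:E * (g w)%:E))%E.
  have -> : (\int[P]_w ((f (X w))%:E * (g w)%:E) =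
      \int[P]_w limn (fun n => (phi n (X w))%:E * (g w)%:E))%E.
    apply: eq_integral => w _; apply/esym/cvg_lim => //.
    by apply: cvgeZr => //; exact: phi_cvg.
  apply: (@cvg_monotone_convergence _ _ _ P setT measurableT
     (fun n w => (phi n (X w))%:E * (g w)%:E)%E) => //.
  - by move=> n; apply: emeasurable_funM.
  - by move=> n w _; rewrite mule_ge0// lee_fin.
  - by move=> w _ m n mn; rewrite lee_wpmul2r ?lee_fin//; have := phi_nd (X w) _ _ mn; rewrite lee_fin.
have C2 : (c%:E * \int[P]_w (phi n (X w))%:E)%E @[n --> \oo] -->
    (c%:E * \int[P]_w (f (X w))%:E)%E.
  apply: cvgeZl => //.
  have -> : (\int[P]_w (f (X w))%:E = \int[P]_w limn (fun n => (phi n (X w))%:E))%E.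
    by apply: eq_integral => w _; apply/esym/cvg_lim => //; exact: phi_cvg.
  apply: (@cvg_monotone_convergence _ _ _ P setT measurableT
     (fun n w => (phi n (X w))%:E)) => //.
  by move=> n w _; rewrite lee_fin.
have e1 := cvg_lim (@ereal_hausdorff R) C1; have e2 := cvg_lim (@ereal_hausdorff R) C2.
rewrite -[LHS]e1 -[RHS]e2.
by congr (lim (_ @ \oo)); apply/funext => n; exact: L.
Qed.

Variables (I : choiceType) (X : I -> {RV P >-> R}).
Hypothesis indep : mutually_independent X.

Definition joint_event (K : seq I) (E : I -> set R) : set T :=
  [set w | forall i, i \in K -> E i (X i w)].

Lemma joint_event_cons j K E : j \notin K ->
  joint_event (j :: K) E = X j @^-1` E j `&` joint_event K E.
Proof.
move=> jK; apply/seteqP; split => [w H|w [Hj HK] i].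
  split; first by apply: H; exact: mem_head.
  by move=> i iK; apply: H; rewrite inE iK orbT.
by rewrite inE => /predU1P[->//|]; exact: HK.
Qed.

Lemma measurable_joint_event K E : (forall i, measurable (E i)) ->
  measurable (joint_event K E).
Proof.
move=> mE; rewrite (_ : joint_event K E = \big[setI/setT]_(i <- K) (X i @^-1` E i)).
  apply: bigsetI_measurable => i _.
  by rewrite -[X in measurable X]setTI; exact: measurable_funP.
elim: K => [|j K IH].
  by rewrite big_nil; apply/seteqP; split.
rewrite big_cons -IH; apply/seteqP; split => [w H|w [Hj HK] i].
  split; first by apply: H; exact: mem_head.
  by move=> i iK; apply: H; rewrite inE iK orbT.
by rewrite inE => /predU1P[->//|]; exact: HK.
Qed.

Variables (f : I -> R -> R) (e : I -> R).
Hypothesis mf : forall i, measurable_fun setT (f i).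
Hypothesis f_ge0 : forall i x, 0 <= f i x.
Hypothesis f_mean : forall i, (\int[P]_w (f i (X i w))%:E = (e i)%:E)%E.

Let mfX i : measurable_fun setT (fun w => f i (X i w)).
Proof. by apply: measurableT_comp. Qed.

Let e_ge0 i : 0 <= e i.
Proof.
by rewrite -lee_fin -f_mean; apply: integral_ge0 => w _; rewrite lee_fin.
Qed.

Let prod_ge0 J w : 0 <= \prod_(i <- J) f i (X i w).
Proof. by apply: prodr_ge0. Qed.

(** [mutually_independent] speaks of events only, so the variables are converted one by one: those
    in [J] already enter through functions, those in [K] still through events. Converting [j] uses
    the induction hypothesis with [j] among the events, hence the generality in [K]. *)
Lemma expectation_prod_on (J K : seq I) (E : I -> set R) : uniq (J ++ K) ->
  (forall i, measurable (E i)) ->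
  (\int[P]_(w in joint_event K E) (\prod_(i <- J) f i (X i w))%:E =
   (\prod_(i <- J) e i)%:E * P (joint_event K E))%E.
Proof.
elim: J K E => [|j J IH] K E.
  move=> _ mE; under eq_integral do rewrite big_nil.
  rewrite integral_cst ?big_nil//; exact: measurable_joint_event.
rewrite cat_cons cons_uniq mem_cat negb_or => /andP[/andP[jJ jK] uJK] mE.
have mK := measurable_joint_event K mE.
have uK : uniq K by move: uJK; rewrite cat_uniq => /and3P[].
pose g w := \1_(joint_event K E) w * \prod_(i <- J) f i (X i w).
pose c := \prod_(i <- J) e i * fine (P (joint_event K E)).
have mg : measurable_fun setT g.
  by apply: measurable_funM; [exact: measurable_indic|exact: measurable_prod].
have g0 w : 0 <= g w by rewrite mulr_ge0// indicE ler0n.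
have c0 : 0 <= c by rewrite mulr_ge0 ?prodr_ge0// fine_ge0.
have H F : measurable F ->
    (\int[P]_(w in X j @^-1` F) (g w)%:E = c%:E * P (X j @^-1` F))%E.
  move=> mF; pose E' i := if i == j then F else E i.
  have mE' i : measurable (E' i) by rewrite /E'; case: ifP.
  have EK : joint_event K E' = joint_event K E.
    apply/seteqP; split => w H i iK; have := H i iK; rewrite /E';
    by rewrite (negPf (memPn jK i iK)).
  have -> : (\int[P]_(w in X j @^-1` F) (g w)%:E =
     \int[P]_(w in joint_event (j :: K) E') (\prod_(i <- J) f i (X i w))%:E)%E.
    rewrite joint_event_cons// {1}/E' eqxx EK integral_mkcondr.
    apply: eq_integral => w _; rewrite patchE /g indicE.
    by case: ifP => _; rewrite ?mul1r ?mul0r.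
  rewrite IH//; last first.
    move: uJK; rewrite !cat_uniq/= => /and3P[-> h ->].
    by rewrite jK negb_or jJ h.
  rewrite {1}/joint_event indep//; last by rewrite cons_uniq jK.
  rewrite big_cons -indep// -/(joint_event K E') EK {1}/E' eqxx /c EFinM.
  rewrite fineK ?fin_num_measure// -muleA; congr (_ * _)%E.
  by rewrite muleC.
have := integral_mul_of_sets mg g0 c0 H (mf j) (f_ge0 j).
rewrite f_mean /c -EFinM.
move=> Heq; rewrite integral_mkcond.
have -> : (\int[P]_w ((fun w => (\prod_(i <- j :: J) f i (X i w))%:E) \_ (joint_event K E)) w =
   \int[P]_w ((f j (X j w))%:E * (g w)%:E))%E.
  apply: eq_integral => w _; rewrite patchE /g indicE big_cons -EFinM.
  by case: ifP => _; rewrite ?mul1r ?mul0r ?mulr0.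
rewrite Heq big_cons -[in RHS](fineK (fin_num_measure P _ mK)) -EFinM.
by congr (_%:E); ring.
Qed.

Lemma expectation_prod (J : seq I) : uniq J ->
  (\int[P]_w (\prod_(i <- J) f i (X i w))%:E = (\prod_(i <- J) e i)%:E)%E.
Proof.
move=> uJ; have := @expectation_prod_on J [::] (fun=> setT).
rewrite cats0 => /(_ uJ (fun=> measurableT)).
rewrite (_ : joint_event [::] _ = setT) ?probability_setT ?mule1//.
by apply/seteqP; split.
Qed.

End ProductExpectation.

(** * Moment generating functions and the decay rate *)

Section MomentGeneratingFunction.
Context {d : measure_display} {T : measurableType d} {R : realType}.
Variable P : probability T R.

Lemma measurable_set_lt (f g : T -> R) : measurable_fun setT f ->
  measurable_fun setT g -> measurable [set w | f w < g w].
Proof.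
move=> mf mg; rewrite -[Y in measurable Y]setTI.
under eq_set => w do rewrite -lte_fin.
by apply: measurable_lte => //; exact/measurable_EFinP.
Qed.

Lemma measurable_set_le (f g : T -> R) : measurable_fun setT f ->
  measurable_fun setT g -> measurable [set w | f w <= g w].
Proof.
by move=> mf mg; rewrite -[X in measurable X]setTI; exact: measurable_fun_le.
Qed.

Lemma mgfE (X : {RV P >-> R}) t :
  'M_P X t = (\int[P]_w (expR (t * X w))%:E)%E.
Proof.
rewrite /mmt_gen_fun unlock; apply: eq_integral => w _ /=.
by rewrite mulrC.
Qed.

Lemma measurable_expRM (X : {RV P >-> R}) (t : R) :
  measurable_fun setT (fun w => expR (t * X w)).
Proof.
apply: measurableT_comp => //; apply: measurable_funM => //.
Qed.

Lemma ge0_integral_gt0 (f : T -> R) : measurable_fun setT f ->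
  (forall w, 0 <= f w) -> (0 < P [set w | (0 < f w)%R])%E ->
  (0 < \int[P]_w (f w)%:E)%E.
Proof.
move=> mf f0 Pf; rewrite lt0e integral_ge0 ?andbT; last by move=> w _; rewrite lee_fin.
apply/eqP => int0.
have mEf : measurable_fun setT (EFin \o f) by exact/measurable_EFinP.
have : ae_eq P setT (EFin \o f) (cst 0%E).
  apply/ae_eq_integral_abs => //; rewrite -int0.
  by apply: eq_integral => w _; rewrite gee0_abs//= lee_fin.
move=> [N [mN N0 subN]]; move: Pf; rewrite ltNge -N0 le_measure ?inE//.
  exact: measurable_set_lt.
move=> w /= fw; apply: subN => /= /(_ I) [fw0]; by move: fw; rewrite fw0 ltxx.
Qed.

Variable X : {RV P >-> R}.
Hypothesis X_ge0 : forall w, 0 <= X w.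

Lemma measurable_RV (E : set R) : measurable E -> measurable (X @^-1` E).
Proof. by move=> mE; rewrite -[_ @^-1` _]setTI; exact: measurable_funP. Qed.

Lemma mgf_ge0 t : (0 <= 'M_P X t)%E.
Proof. by rewrite mgfE integral_ge0// => w _; rewrite lee_fin expR_ge0. Qed.

Lemma mgf_le1 t : t <= 0 -> ('M_P X t <= 1)%E.
Proof.
move=> t0; rewrite mgfE -(@probability_setT _ _ _ P) -[leRHS]mul1e -integral_cst//.
apply: ge0_le_integral => //.
- by apply/measurable_EFinP; exact: measurable_expRM.
- by move=> w _; rewrite lee_fin expR_le1 mulr_le0_ge0.
Qed.

Lemma mgf_ge1 t : 0 <= t -> (1 <= 'M_P X t)%E.
Proof.
move=> t0; rewrite mgfE -(@probability_setT _ _ _ P) -[leLHS]mul1e -integral_cst//.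
apply: ge0_le_integral => //.
- by apply/measurable_EFinP; exact: measurable_expRM.
- by move=> w _; rewrite lee_fin -expR0 ler_expR mulr_ge0.
Qed.

Lemma mgf0 : 'M_P X 0 = 1%E.
Proof.
by apply/le_anti; rewrite mgf_le1// mgf_ge1.
Qed.

Lemma mgf_fin_num t : t <= 0 -> 'M_P X t \is a fin_num.
Proof.
move=> t0; rewrite ge0_fin_numE ?mgf_ge0//.
by rewrite (le_lt_trans (mgf_le1 t0))// ltry.
Qed.

Hypothesis X_neq0 : (P [set w | X w = 0%R] < 1)%E.

Lemma X_gt0 : (0 < P [set w | (0 < X w)%R])%E.
Proof.
have -> : [set w | 0 < X w] = ~` [set w | X w = 0].
  apply/seteqP; split => w /=; first by move=> + X0; rewrite X0 ltxx.
  by move=> /eqP X0; rewrite lt0r X0/=.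
rewrite probability_setC; first by rewrite sube_gt0.
exact: (@measurable_RV [set 0]).
Qed.

Lemma mgf_lt y y' : y < y' -> 'M_P X y \is a fin_num -> ('M_P X y < 'M_P X y')%E.
Proof.
move=> yy' fy.
pose f w := expR (y' * X w) - expR (y * X w).
have f0 w : 0 <= f w by rewrite subr_ge0 ler_expR ler_wpM2r// ltW.
have mf : measurable_fun setT f by apply: measurable_funB; exact: measurable_expRM.
have -> : 'M_P X y' = ('M_P X y + \int[P]_w (f w)%:E)%E.
  rewrite !mgfE -ge0_integralD//.
  - by apply: eq_integral => w _; rewrite -EFinD /f addrC subrK.
  - by apply/measurable_EFinP; exact: measurable_expRM.
  - by move=> w _; rewrite lee_fin.
  - exact/measurable_EFinP.
rewrite lteDl//; apply: ge0_integral_gt0 => //.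
apply: (lt_le_trans X_gt0); rewrite le_measure ?inE//.
- exact: measurable_set_lt.
- exact: measurable_set_lt.
- by move=> w /= Xw; rewrite subr_gt0 ltr_expR ltr_pM2r.
Qed.

Lemma mgf_gt_atom y : (P [set w | X w = 0%R] < 'M_P X y)%E.
Proof.
have m0 : measurable [set w | X w = 0] by exact: (@measurable_RV [set 0]).
pose f w := expR (y * X w) - \1_[set w | X w = 0] w.
have f0 w : 0 <= f w.
  rewrite subr_ge0 indicE; have [X0|X0] := pselect (X w = 0).
    by rewrite X0 mulr0 expR0; case: (_ \in _).
  by rewrite memNset ?expR_ge0.
have mf : measurable_fun setT f by apply: measurable_funB => //; exact: measurable_expRM.
have -> : 'M_P X y = (P [set w | X w = 0%R] + \int[P]_w (f w)%:E)%E.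
  have -> : P [set w | X w = 0%R] = (\int[P]_w (\1_[set w | X w = 0%R] w)%:E)%E.
    by rewrite integral_indic// setIT.
  rewrite mgfE -ge0_integralD//.
  - by apply: eq_integral => w _; rewrite -EFinD /f addrC subrK.
  - by apply/measurable_EFinP.
  - by move=> w _; rewrite lee_fin.
  - exact/measurable_EFinP.
rewrite lteDl ?fin_num_measure//; apply: ge0_integral_gt0 => //.
apply: (lt_le_trans X_gt0); rewrite le_measure ?inE//.
- exact: measurable_set_lt.
- exact: measurable_set_lt.
- move=> w /= Xw; rewrite subr_gt0 indicE memNset ?expR_gt0//=.
  by move=> X0; rewrite X0 ltxx in Xw.
Qed.

(** Capping the exponent at 0 keeps the integrand below 1, so dominated convergence gives continuity
    on the whole line and the endpoint 0 needs no separate treatment. *)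
Let H (t : R) : \bar R := (\int[P]_w (expR (Num.min t 0 * X w))%:E)%E.

Let H_cvg (u : nat -> R) (l : R) : u n @[n --> \oo] --> l -> H (u n) @[n --> \oo] --> H l.
Proof.
move=> ul; apply: (@dominated_cvg _ _ _ P setT measurableT
   (fun n w => (expR (Num.min (u n) 0 * X w))%:E) _ (cst 1%E)) => //.
- by move=> n; apply/measurable_EFinP; exact: measurable_expRM.
- move=> w _; apply: cvg_EFin; first by apply: nearW.
  have ch : {for l, continuous (fun t : R => expR (Num.min t 0 * X w))}.
    apply: (@continuous_comp _ _ _ (fun t : R => Num.min t 0 * X w) expR).
      apply: cvgM; last exact: cvg_cst.
      by apply: (@continuous_min R R id (cst 0) l); [exact: cvg_id|exact: cvg_cst].
    exact: continuous_expR.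
  exact: (@cvg_comp _ _ _ u (fun t : R => expR (Num.min t 0 * X w)) _ _ _ ul ch).
- by apply/integrableP; split => //; rewrite integral_cst//= probability_setT normr1 mule1 ltry.
- move=> n w _; rewrite gee0_abs ?lee_fin ?expR_ge0// expR_le1 mulr_le0_ge0//.
  by rewrite ge_min lexx orbT.
Qed.

Let HE (t : R) : t <= 0 -> H t = 'M_P X t.
Proof. by move=> t0; rewrite mgfE /H min_l. Qed.

Lemma mgf_cvg_atom : 'M_P X (- n%:R) @[n --> \oo] --> P [set w | X w = 0%R].
Proof.
have m0 : measurable [set w | X w = 0] by exact: (@measurable_RV [set 0]).
have -> : P [set w | X w = 0%R] = (\int[P]_w (\1_[set w | X w = 0%R] w)%:E)%E.
  by rewrite integral_indic// setIT.
under eq_cvg do rewrite mgfE.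
apply: (@dominated_cvg _ _ _ P setT measurableT
   (fun n w => (expR (- n%:R * X w))%:E) _ (cst 1%E)) => //.
- by move=> n; apply/measurable_EFinP; exact: measurable_expRM.
- move=> w _; apply: cvg_EFin; first by apply: nearW.
  suff h : expR (- n%:R * X w) @[n --> \oo] --> (\1_[set w | X w = 0] w : R) by exact: h.
  rewrite indicE; have [X0|X0] := pselect (X w = 0).
    rewrite mem_set//= (_ : (fun n : nat => _) = cst 1); first exact: cvg_cst.
    by apply/funext => n; rewrite X0 mulr0 expR0.
  rewrite memNset//=.
  have Xp : 0 < X w by rewrite lt0r X_ge0 andbT; exact/eqP.
  have -> : (fun n => expR (- n%:R * X w)) = (fun n => expR (- X w) ^+ n).
    by apply/funext => n; rewrite -expRM_natr mulNr mulrC mulNr.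
  by apply: cvg_expr; rewrite ger0_norm ?expR_ge0// expR_lt1 oppr_lt0.
- by apply/integrableP; split => //; rewrite integral_cst//= probability_setT normr1 mule1 ltry.
- move=> n w _; rewrite gee0_abs ?lee_fin ?expR_ge0// expR_le1 mulr_le0_ge0//.
Qed.

Lemma mgf_surj u : (P [set w | X w = 0%R] < u)%E -> (u <= 1)%E ->
  exists2 y, y <= 0 & 'M_P X y = u.
Proof.
move=> Pu u1.
have Pf : P [set w | X w = 0] \is a fin_num.
  by rewrite fin_num_measure//; exact: (@measurable_RV [set 0]).
have [N HN] : exists N : nat, ('M_P X (- N%:R) < u)%E.
  have [N _ HN] := mgf_cvg_atom (open_ereal_lt' Pu).
  by exists N; exact: (HN N (leqnn N)).
have ufin : u \is a fin_num.
  rewrite ge0_fin_numE; first by rewrite (le_lt_trans u1)// ltry.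
  by rewrite (le_trans _ (ltW Pu)).
have Hfin t : H t \is a fin_num by rewrite /H -mgfE mgf_fin_num// ge_min lexx orbT.
have cH : continuous (fine \o H).
  move=> t; apply/(@cvg_nbhsP _ R^o) => v vt.
  apply: fine_cvg; rewrite fineK//; exact: H_cvg.
have N0 : - N%:R <= 0 :> R by rewrite oppr_le0.
have [|y] := @IVT R (fine \o H) (- N%:R) 0 (fine u) N0 (continuous_subspaceT cH).
  rewrite /= !HE// mgf0/= ge_min le_max (fine_le _ _ u1)// orbT andbT.
  by rewrite fine_le ?mgf_fin_num// ltW.
rewrite in_itv/= => /andP[_ y0] Hy; exists y => //.
by rewrite -HE// -(fineK (Hfin y)) Hy fineK.
Qed.

End MomentGeneratingFunction.

(** * [Psi] and [gamma_p] as inequalities between moment generating functions *)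

Section DecayRate.
Context {d : measure_display} {T : measurableType d} {R : realType}.
Variable P : probability T R.
Variables A B : {RV P >-> R}.
Hypothesis A_ge0 : forall w, 0 <= A w.
Hypothesis B_ge0 : forall w, 0 <= B w.
Hypothesis A_neq0 : (P [set w | A w = 0%R] < 1)%E.

Lemma mgf_inv_spec u : (P [set w | A w = 0%R] < u)%E -> (u <= 1)%E ->
  exists y, [/\ y <= 0, mgf_inv A u = y%:E & 'M_P A y = u].
Proof.
move=> Pu u1; have [y y0 Ay] := mgf_surj A_ge0 Pu u1.
exists y; split => //; rewrite /mgf_inv leNgt Pu/= -Ay pinvKV ?inE//.
move=> x z /[!inE]/= x0 z0 xz.
by case: (ltgtP x z) => // /(mgf_lt A_ge0 A_neq0); rewrite mgf_fin_num// xz ltxx => /(_ isT).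
Qed.

Lemma inve_mgf_le1 s : 0 <= s -> (('M_P B s)^-1 <= 1)%E.
Proof.
move=> s0; have := mgf_ge1 B_ge0 s0.
case: ('M_P B s) => [m| |]//; last by rewrite invey lee_fin.
by rewrite lee_fin => m1; rewrite inver gt_eqF ?(lt_le_trans ltr01)// lee_fin invf_le1 ?(lt_le_trans ltr01).
Qed.

Lemma Psi_ge0 s : 0 <= s -> (0 <= Psi A B s)%E.
Proof.
move=> s0; rewrite /Psi.
have [Pu|Pu] := leP ('M_P B s)^-1%E (P [set w | A w = 0%R]).
  by rewrite /mgf_inv Pu/= leey.
have [y [y0 -> _]] := mgf_inv_spec Pu (inve_mgf_le1 s0).
by rewrite -EFinN lee_fin oppr_ge0.
Qed.

(** Finiteness of $\Phi_B(s)$ comes along: otherwise $1/\infty=0\le\mathbb{P}\{A=0\}$ and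
    $\Psi(s)=+\infty$. The rest is strict monotonicity of $\Phi_A$. *)
Lemma Psi_lt_mgf s c : 0 <= s -> (Psi A B s < c%:E)%E ->
  'M_P B s \is a fin_num /\ ('M_P A (- c) * 'M_P B s < 1)%E.
Proof.
move=> s0; rewrite /Psi.
have [Pu|Pu] := leP ('M_P B s)^-1%E (P [set w | A w = 0%R]).
  by rewrite /mgf_inv Pu/=.
have [y [y0 -> Ay]] := mgf_inv_spec Pu (inve_mgf_le1 s0).
rewrite -EFinN lte_fin ltrNl => cy.
have := mgf_lt A_ge0 A_neq0 cy; rewrite Ay.
have -> : 'M_P A (- c) \is a fin_num.
  by rewrite mgf_fin_num// (le_trans (ltW cy)).
move=> /(_ isT).
have := mgf_ge1 B_ge0 s0; move: Pu; case: ('M_P B s) => [m| |]//.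
  rewrite lee_fin => _ m1.
  have m0 : 0 < m by rewrite (lt_le_trans ltr01).
  rewrite inver gt_eqF// => H; split => //.
  by rewrite -lte_pdivlMr// mul1e.
by rewrite invey ltNge measure_ge0.
Qed.

(** When $\Psi(s)=+\infty$ by convention, the claim survives because $\Phi_A$ stays strictly above
    $\mathbb{P}\{A=0\}\ge1/\Phi_B(s)$. *)
Lemma Psi_gt_mgf s c : 0 <= s -> (c%:E < Psi A B s)%E ->
  (1 < 'M_P A (- c) * 'M_P B s)%E.
Proof.
move=> s0 cPsi.
have MA0 : (0 < 'M_P A (- c))%E.
  by rewrite (le_lt_trans _ (mgf_gt_atom A_ge0 A_neq0 _)).
suff : (('M_P B s)^-1 < 'M_P A (- c))%E.
  have := mgf_ge1 B_ge0 s0; case: ('M_P B s) => [m| |]//.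
    rewrite lee_fin => m1.
    have m0 : 0 < m by rewrite (lt_le_trans ltr01).
    rewrite inver gt_eqF// => H.
    by rewrite -lte_pdivrMr// mul1e.
  by move=> _ _; rewrite gt0_muley// ltry.
have [Pu|Pu] := leP ('M_P B s)^-1%E (P [set w | A w = 0%R]).
  exact: le_lt_trans Pu (mgf_gt_atom A_ge0 A_neq0 _).
have [y [y0 Ey Ay]] := mgf_inv_spec Pu (inve_mgf_le1 s0).
rewrite -Ay; apply: mgf_lt => //; last by rewrite mgf_fin_num.
by move: cPsi; rewrite /Psi Ey -EFinN lte_fin ltrNr.
Qed.

Lemma lt_gamma_p theta : (theta%:E < gamma_p A B)%E ->
  exists2 s, 0 <= s & (Psi A B s < (s - theta)%:E)%E.
Proof.
move=> /ereal_sup_gt[_ [s s0 <-]] H; exists s => //.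
move: H; case: (Psi A B s) => [p| |]//=; last by rewrite ltNyr.
by rewrite -EFinB !lte_fin ltrBrDr ltrBrDl addrC.
Qed.

Lemma gamma_p_lt theta : (gamma_p A B < theta%:E)%E ->
  forall s, 0 <= s -> ((s - theta)%:E < Psi A B s)%E.
Proof.
move=> gt s s0.
have : (s%:E - Psi A B s < theta%:E)%E.
  by apply: le_lt_trans gt; apply: ereal_sup_ubound; exists s.
case: (Psi A B s) => [p| |]//=; last by rewrite ltry.
by rewrite -EFinB !lte_fin ltrBlDr ltrBlDr addrC.
Qed.

Lemma gamma_p_ge0 : (0 <= gamma_p A B)%E.
Proof.
apply: (@le_trans _ _ (0%:E - Psi A B 0)%E); last first.
  by apply: ereal_sup_ubound; exists 0 => /=.
rewrite /Psi mgf0// inve1 oppeK add0e.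
have [y [y0 -> Ay]] := mgf_inv_spec A_neq0 (lexx 1%E).
rewrite lee_fin leNgt; apply/negP => /(mgf_lt A_ge0 A_neq0).
by rewrite mgf_fin_num// Ay mgf0// ltxx => /(_ isT).
Qed.

End DecayRate.

(** * Upper bound *)

Section SameLaw.
Context {d : measure_display} {T : measurableType d} {R : realType}.
Variable P : probability T R.

Lemma same_law_integral (X Y : {RV P >-> R}) (f : R -> R) : same_law X Y ->
  measurable_fun setT f -> (forall x, 0 <= f x) ->
  (\int[P]_w (f (X w))%:E = \int[P]_w (f (Y w))%:E)%E.
Proof.
move=> XY mf f0.
have mEf : measurable_fun setT (EFin \o f) by exact/measurable_EFinP.
have E (Z : {RV P >-> R}) : (\int[P]_w (f (Z w))%:E = \int[distribution P Z]_y (EFin \o f) y)%E.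
  by rewrite ge0_integral_distribution// => y; rewrite lee_fin.
rewrite !E; apply: eq_measure_integral => S mS _; exact: XY.
Qed.

Lemma markov_ge0 (Y : T -> R) (c : R) : measurable_fun setT Y ->
  (forall w, 0 <= Y w) -> 0 < c ->
  (P [set w | (c <= Y w)%R] <= c^-1%:E * \int[P]_w (Y w)%:E)%E.
Proof.
move=> mY Y0 c0.
have mEY : measurable_fun setT (EFin \o Y) by exact/measurable_EFinP.
have := @le_integral_abse _ _ _ P _ measurableT (EFin \o Y) c mEY c0.
rewrite setTI => H; rewrite -lee_pdivlMl// in H.
move: H; congr (_ <= _)%E.
  by congr (P _); apply/seteqP; split => w /=; rewrite lee_fin ger0_norm.
by congr (_ * _)%E; apply: eq_integral => w _; rewrite gee0_abs//= lee_fin.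
Qed.

End SameLaw.

Lemma geometric_sum_le (R : realType) (q : R) n : 0 <= q -> q < 1 ->
  \sum_(j < n) q ^+ j <= (1 - q)^-1.
Proof.
move=> q0 q1; have q1' : 0 < 1 - q by rewrite subr_gt0.
rewrite -[leRHS]mul1r ler_pdivlMr// mulrC.
rewrite -{1}opprB mulNr -subrX1 opprB gerBl exprn_ge0//.
Qed.

(** * Chernoff bound summed over busy periods *)

Section UpperBound.
Context {R : realType} {d : measure_display} {T : measurableType d}.
Variables (P : probability T R) (A B : nat -> {RV P >-> R}).
Hypothesis A_ge0 : forall n w, 0 <= A n w.
Hypothesis B_ge0 : forall n w, 0 <= B n w.
Hypothesis A_same_law : forall n, same_law (A n) (A 0%N).
Hypothesis B_same_law : forall n, same_law (B n) (B 0%N).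
Hypothesis AB_independent : mutually_independent
  (fun i : nat + nat => match i with inl n => A n | inr n => B n end).
Variable r : T -> nat -> R -> R.
Hypothesis r_srpt : {ae P, forall w, preemptive_srpt (A ^~ w) (B ^~ w) (r w)}.
Variable V : nat -> {RV P >-> R}.
Hypothesis V_sojourn : forall n,
  {ae P, forall w, (V n w)%:E = sojourn_time (A ^~ w) (r w) n}.

Variables (s psi mA mB : R).
Hypothesis psi_gt0 : 0 < psi.
Hypothesis psi_lt_s : psi < s.
Hypothesis mAE : 'M_P (A 0%N) (- psi) = mA%:E.
Hypothesis mBE : 'M_P (B 0%N) s = mB%:E.
Hypothesis mAB_lt1 : mA * mB < 1.

Let q := mA * mB.

Let mA_ge0 : 0 <= mA. Proof. by rewrite -lee_fin -mAE mgf_ge0. Qed.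

Let mB_ge1 : 1 <= mB.
Proof.
rewrite -lee_fin -mBE mgf_ge1//.
by rewrite ltW// (lt_trans psi_gt0).
Qed.

Let q_ge0 : 0 <= q.
Proof. by rewrite mulr_ge0// (le_trans ler01). Qed.

Let mA_le_q : mA <= q. Proof. by rewrite ler_peMr. Qed.

(** The services run over [k], ..., [m] but the interarrival times only up to [m - 1], the times
    between the arrivals of [k] and [m]; hence the extra factor [mB] in the mean. *)
Let Y k m w := (\prod_(k <= i < m) expR (- psi * A i w)) *
  (\prod_(k <= i < m.+1) expR (s * B i w)).

Let Y_ge0 k m w : 0 <= Y k m w.
Proof. by rewrite mulr_ge0// prodr_ge0// => i _; exact: expR_ge0. Qed.

Let mY k m : measurable_fun setT (Y k m).
Proof.
by apply: measurable_funM; apply: measurable_prod => i _; exact: measurable_expRM.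
Qed.

Let f (i : nat + nat) (x : R) : R :=
  match i with inl _ => expR (- psi * x) | inr _ => expR (s * x) end.

Let expectation_AB (J : seq (nat + nat)) : uniq J ->
  (\int[P]_w (\prod_(i <- J) f i (match i with inl n => A n | inr n => B n end w))%:E =
  (\prod_(i <- J) match i with inl _ => mA | inr _ => mB end)%:E)%E.
Proof.
have mexp (c : R) : measurable_fun setT (fun x : R => expR (c * x)).
  by apply: measurableT_comp => //; exact: measurable_funM.
apply: (expectation_prod AB_independent) => [[i|i]|[i|i] x|[i|i]].
- exact: mexp.
- exact: mexp.
- exact: expR_ge0.
- exact: expR_ge0.
- rewrite /f -mAE mgfE.
  by apply: (@same_law_integral _ _ _ _ _ _ (fun x => expR (- psi * x))) => // x; exact: expR_ge0.
- rewrite /f -mBE mgfE.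
  by apply: (@same_law_integral _ _ _ _ _ _ (fun x => expR (s * x))) => // x; exact: expR_ge0.
Qed.

Let uniq_lr k m l : uniq ([seq inl i | i <- index_iota k m] ++
  [seq inr i | i <- index_iota k l] : seq (nat + nat)).
Proof.
rewrite cat_uniq !map_inj_uniq ?iota_uniq ?andbT/=; [|by move=> ? ? []..].
by apply/hasPn => _ /mapP[i _ ->]; apply/negP => /mapP[].
Qed.

Let expectation_Y k m : (k <= m)%N ->
  (\int[P]_w (Y k m w)%:E = (mB * q ^+ (m - k))%:E)%E.
Proof.
move=> km; have := expectation_AB (uniq_lr k m m.+1).
under eq_integral do rewrite big_cat !big_map/=.
rewrite big_cat !big_map/= => ->.
rewrite !prodr_const_nat subSn// exprS /q exprMn mulrCA; congr _%:E.
Qed.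

(* Chernoff: if the busy period started by [k] still runs at time [T_n + x],
   after the arrivals up to [m], then [expR ((s - psi) * x) <= Y k m]. *)
Lemma sojourn_tail_upper : exists C : R, forall n (x : R), 0 <= x ->
  (P [set w | (x < V n w)%R] <= (C * expR (- (s - psi) * x))%:E)%E.
Proof.
have q1 : 0 < (1 - q)^-1 by rewrite invr_gt0 subr_gt0.
exists (mB * (1 - q)^-1 ^+ 2) => n x x0.
pose c := expR ((s - psi) * x).
have c0 : 0 < c by exact: expR_gt0.
pose F k m := [set w | c <= Y k m w].
(* The event that [J] further arrivals occur within time [x] after customer [n]. It cuts the sum
   over the last arrival to finitely many terms; its probability is at most $e^{\psi x}m_A^J$, and
   [J] tends to infinity at the end. *)
pose N J := [set w | expR (- psi * x) <= \prod_(n <= i < n + J) expR (- psi * A i w)].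
have mprod J : measurable_fun setT
    (fun w => \prod_(n <= i < n + J) expR (- psi * A i w)).
  by apply: measurable_prod => i _; exact: measurable_expRM.
have mF k m : measurable (F k m) by exact: measurable_set_le.
have mN J : measurable (N J) by exact: measurable_set_le.
have PF k m : (k <= m)%N -> (P (F k m) <= (c^-1 * (mB * q ^+ (m - k)))%:E)%E.
  by move=> km; rewrite EFinM -expectation_Y// markov_ge0.
have PN J : (P (N J) <= (expR (psi * x) * mA ^+ J)%:E)%E.
  have uJ : uniq ([seq inl i | i <- index_iota n (n + J)] : seq (nat + nat)).
    by rewrite map_inj_uniq ?iota_uniq// => ? ? [].
  have := expectation_AB uJ; under eq_integral do rewrite big_map.
  rewrite big_map prodr_const_nat addKn => H.
  rewrite EFinM -H -[psi * x]opprK expRN -mulNr markov_ge0//; last exact: expR_gt0.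
  by move=> w; apply: prodr_ge0 => i _; exact: expR_ge0.
have VF J : (P [set w | (x < V n w)%R] <= P (N J) +
    \sum_(k < n.+1) \sum_(j < J) P (F k (n + j)%N))%E.
  have [Z [mZ Z0 subZ]] := filterI r_srpt (V_sojourn n).
  pose U k := \big[setU/set0]_(j < J) F k (n + j)%N.
  have mU k : measurable (U k) by apply: bigsetU_measurable.
  pose UU := \big[setU/set0]_(k < n.+1) U k.
  have mUU : measurable UU by apply: bigsetU_measurable.
  have sub : [set w | x < V n w] `<=` Z `|` (N J `|` UU).
    move=> w /= xV; have [wZ|wZ] := pselect (Z w); [by left|right].
    have [srpt Vw] : preemptive_srpt (A ^~ w) (B ^~ w) (r w) /\
        (V n w)%:E = sojourn_time (A ^~ w) (r w) n.
      by apply: contrapT => nh; apply: wZ; exact: subZ.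
    have Aw i : 0 <= A i w by [].
    have Bw i : 0 <= B i w by [].
    have [wN|wN] := pselect (N J w); [by left|right].
    have busy := @sojourn_time_gt R (A ^~ w) (r w) n x.
    rewrite -Vw lte_fin in busy; move/(_ xV) in busy.
    have tJ : arrival_time (A ^~ w) n + x < arrival_time (A ^~ w) (n + J).
      rewrite ltNge; apply/negP => H; apply: wN; rewrite /N/= -expR_sum ler_expR.
      rewrite -mulr_sumr !mulNr lerN2 ler_pM2l//.
      rewrite -(arrival_time_sub (A ^~ w))//; last exact: leq_addr.
      by rewrite lerBlDl.
    have nx : arrival_time (A ^~ w) n <= arrival_time (A ^~ w) n + x by rewrite lerDl.
    have [m [nm mJ tm mt]] := arrival_index (leq_addr J n) nx tJ.
    have [k kn work] := busy_period_work Aw Bw srpt nm x0 tm mt busy.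
    rewrite /UU -bigcup_mkord; exists k => //=.
    rewrite /U -(bigcup_mkord _ (fun j => F k (n + j)%N)); exists (m - n)%N => /=.
      by rewrite ltn_subLR.
    rewrite subnKC// /F/= /c /Y -!expR_sum -expRD ler_expR -!mulr_sumr.
    rewrite -(arrival_time_sub (A ^~ w)) ?(leq_trans kn)//.
    have tkn := arrival_time_le Aw kn.
    have s0 : 0 <= s by rewrite ltW// (lt_trans psi_gt0).
    (* With $t$ the arrival times, the exponent of [Y k m] is at least
       $s(x+t_n-t_k)-\psi(x+t_n-t_k)$, and $t_n-t_k\ge0$ may be dropped since $\psi<s$. *)
    have h1 := ler_wpM2l s0 work.
    have h2 := ler_wpM2l (ltW psi_gt0) tm.
    have h3 : 0 <= (s - psi) * (arrival_time (A ^~ w) n - arrival_time (A ^~ w) k).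
      by rewrite mulr_ge0// subr_ge0// ltW.
    by lra.
  apply: (@le_trans _ _ (P (Z `|` (N J `|` UU)))).
    by rewrite le_measure ?inE//; [exact: measurable_set_lt|apply: measurableU => //; exact: measurableU].
  apply: (le_trans (measureU2 _ mZ (measurableU _ _ (mN J) mUU))).
  rewrite [X in (X + _)%E]Z0 add0e.
  apply: (le_trans (measureU2 _ (mN J) mUU)); rewrite leeD2l//.
  apply: (@le_trans _ _ (\sum_(k < n.+1) P (U k))%E).
    exact: (@content_subadditive _ _ _ P).
  apply: lee_sum => k _.
  exact: (@content_subadditive _ _ _ P _ (fun j => F k (n + j)%N)).
(* The exponent [n + j - k] splits into [n - k] and [j], so the double sum is a product of two
   geometric sums, bounded independently of [n] and [J]. *)
have S J : (\sum_(k < n.+1) \sum_(j < J) P (F k (n + j)%N) <=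
    (mB * (1 - q)^-1 ^+ 2 * expR (- (s - psi) * x))%:E)%E.
  apply: (@le_trans _ _ (\sum_(k < n.+1) \sum_(j < J)
      (c^-1 * mB * (q ^+ (n - k) * q ^+ j))%:E)%E).
    apply: lee_sum => k _; apply: lee_sum => j _.
    have kn : (k <= n)%N by rewrite -ltnS.
    apply: le_trans (PF _ _ _) _; first by rewrite (leq_trans kn)// leq_addr.
    by rewrite lee_fin -mulrA -exprD addnBAC.
  under eq_bigr do rewrite sumEFin.
  rewrite sumEFin lee_fin.
  under eq_bigr do rewrite -mulr_sumr -mulr_sumr.
  rewrite -mulr_sumr -mulr_suml.
  have -> : \sum_(k < n.+1) q ^+ (n - k) = \sum_(k < n.+1) q ^+ k.
    rewrite (reindex_inj rev_ord_inj)/=; apply: eq_bigr => k _.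
    by rewrite subSS subKn// -ltnS.
  rewrite mulNr expRN -/c [leRHS]mulrC -mulrA ler_wpM2l ?invr_ge0 ?(ltW c0)//.
  rewrite ler_wpM2l ?(le_trans ler01)// expr2.
  by rewrite ler_pM ?geometric_sum_le//; apply: sumr_ge0 => i _; rewrite exprn_ge0.
have bound J : (P [set w | (x < V n w)%R] <=
   (expR (psi * x) * mA ^+ J)%:E + (mB * (1 - q)^-1 ^+ 2 * expR (- (s - psi) * x))%:E)%E.
  by apply: (le_trans (VF J)); rewrite leeD.
apply/lee_addgt0Pr => e e0.
have e1 : 0 < e / expR (psi * x) by rewrite divr_gt0// expR_gt0.
have /cvgrPdist_lt/(_ _ e1) [J _ HJ] : (mA ^+ J) @[J --> \oo] --> (0 : R).
  by apply: cvg_expr; rewrite ger0_norm// (le_lt_trans mA_le_q).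
have := HJ J (leqnn J); rewrite /= sub0r normrN ger0_norm ?exprn_ge0//.
rewrite ltr_pdivlMr ?expR_gt0// => /ltW HJ'.
by apply: (le_trans (bound J)); rewrite addeC leeD2l// lee_fin mulrC.
Qed.

End UpperBound.

(** * Dyadic discretization *)

Section DyadicGrid.
Context {d : measure_display} {T : measurableType d} {R : realType}.

Definition mesh (k : nat) : R := (2 ^+ k)^-1.

Lemma mesh_gt0 k : 0 < mesh k. Proof. by rewrite invr_gt0 exprn_gt0. Qed.

Lemma meshS k : mesh k = 2 * mesh k.+1.
Proof. by rewrite /mesh exprS invfM mulrA divff ?mul1r. Qed.

Lemma mesh_cvg0 : mesh k @[k --> \oo] --> (0 : R).
Proof.
rewrite (_ : mesh = fun k => 2^-1 ^+ k); last by apply/funext => k; rewrite /mesh exprVn.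
by apply: cvg_expr; rewrite ger0_norm ?invr_ge0// invf_lt1// ltr1n.
Qed.

Definition grid_index (k : nat) (x : R) : nat := Num.truncn (x * 2 ^+ k).

Lemma grid_indexP k x i : 0 <= x ->
  (grid_index k x == i) = (i%:R * mesh k <= x < i.+1%:R * mesh k).
Proof.
move=> x0; have k0 : 0 < 2 ^+ k :> R by rewrite exprn_gt0.
by rewrite /grid_index /mesh truncn_eq ?mulr_ge0 ?(ltW k0)// ler_pdivrMr// ltr_pdivlMr.
Qed.

Lemma grid_index_itv k x : 0 <= x ->
  (grid_index k x)%:R * mesh k <= x < (grid_index k x).+1%:R * mesh k.
Proof. by move=> x0; rewrite -grid_indexP. Qed.

Lemma grid_index_lt k x n : 0 <= x -> (grid_index k x < n)%N = (x < n%:R * mesh k).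
Proof.
move=> x0; have /andP[l u] := grid_index_itv k x0.
apply/idP/idP => [H|H].
  by rewrite (lt_le_trans u)// ler_pM2r ?mesh_gt0// ler_nat.
by rewrite -(@ltr_nat R) -(ltr_pM2r (mesh_gt0 k)) (le_lt_trans l).
Qed.

Lemma grid_indexS k x : 0 <= x ->
  ((grid_index k x).*2 <= grid_index k.+1 x)%N /\
  ((grid_index k.+1 x).+1 <= (grid_index k x).+1.*2)%N.
Proof.
move=> x0; have /andP[l u] := grid_index_itv k x0; rewrite meshS in l u.
split; last by rewrite grid_index_lt// -muln2 natrM -mulrA.
by rewrite leqNgt grid_index_lt// -leNgt -muln2 natrM -mulrA.
Qed.

Variables (P : probability T R) (X : {RV P >-> R}).
Hypothesis X_ge0 : forall w, 0 <= X w.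

Definition grid_prob (k i : nat) : R :=
  fine (P [set w | i%:R * mesh k <= X w < i.+1%:R * mesh k]).

Lemma grid_prob_ge0 k i : 0 <= grid_prob k i.
Proof. exact: fine_ge0. Qed.

Let mcell k i : measurable [set w | i%:R * mesh k <= X w < i.+1%:R * mesh k].
Proof.
rewrite (_ : [set w | _] =
  [set w | i%:R * mesh k <= X w] `&` [set w | X w < i.+1%:R * mesh k]).
  by apply: measurableI; [exact: measurable_set_le|exact: measurable_set_lt].
by apply/seteqP; split => w /= => [/andP//|[-> ->]].
Qed.

Lemma grid_probE k i :
  P (X @^-1` `[i%:R * mesh k, i.+1%:R * mesh k[%classic) = (grid_prob k i)%:E.
Proof.
by rewrite /grid_prob fineK ?fin_num_measure//; congr (P _).
Qed.

(** [H] receives both ends of the cell, so that one construction covers rounding down and rounding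
    up. If [H] grows in the first and decreases in the second argument, refining the grid raises the
    value. *)
Definition grid_fun (H : R -> R -> R) (k N : nat) (w : T) : R :=
  let i := grid_index k (X w) in
  if (i < N)%N then H (i%:R * mesh k) (i.+1%:R * mesh k) else 0.

Definition grid_sum (H : R -> R -> R) (k N : nat) : R :=
  \sum_(i < N) grid_prob k i * H (i%:R * mesh k) (i.+1%:R * mesh k).

Variable H : R -> R -> R.
Hypothesis H_ge0 : forall x y : R, 0 <= x -> 0 <= y -> 0 <= H x y.

Let nat_mesh_ge0 i k : 0 <= i%:R * mesh k.
Proof. by rewrite mulr_ge0// ltW// mesh_gt0. Qed.

Lemma grid_fun_ge0 k N w : 0 <= grid_fun H k N w.
Proof. by rewrite /grid_fun; case: ifP => // _; exact: H_ge0. Qed.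

Lemma grid_funE k N w : grid_fun H k N w = \sum_(i < N)
  H (i%:R * mesh k) (i.+1%:R * mesh k) *
  \1_[set w | i%:R * mesh k <= X w < i.+1%:R * mesh k] w.
Proof.
have E i : \1_[set w | i%:R * mesh k <= X w < i.+1%:R * mesh k] w =
    (grid_index k (X w) == i)%:R :> R.
  rewrite indicE grid_indexP//; congr ((nat_of_bool _)%:R).
  by apply/idP/idP; rewrite inE.
rewrite /grid_fun; case: ifPn => [iN|iN].
  rewrite (bigD1 (Ordinal iN))//= E eqxx mulr1 big1 ?addr0// => j ji.
  rewrite E (_ : _ == _ = false) ?mulr0//; apply: contra_neqF ji => /eqP ij.
  exact: val_inj.
rewrite big1// => j _; rewrite E (_ : _ == _ = false) ?mulr0//.
by apply/negbTE; apply: contraNneq iN => ->.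
Qed.

Lemma measurable_grid_fun k N : measurable_fun setT (grid_fun H k N).
Proof.
rewrite (_ : grid_fun H k N = fun w => \sum_(i < N)
  H (i%:R * mesh k) (i.+1%:R * mesh k) *
  \1_[set w | i%:R * mesh k <= X w < i.+1%:R * mesh k] w).
  apply: measurable_sum => i; apply: measurable_funM => //.
by apply/funext => w; exact: grid_funE.
Qed.

Lemma integral_grid_fun k N :
  (\int[P]_w (grid_fun H k N w)%:E = (grid_sum H k N)%:E)%E.
Proof.
under eq_integral do rewrite grid_funE -sumEFin.
rewrite ge0_integral_sum//; last 2 first.
- move=> i; apply/measurable_EFinP; apply: measurable_funM => //.
- by move=> i w _; rewrite lee_fin mulr_ge0 ?H_ge0.
rewrite /grid_sum -sumEFin; apply: eq_bigr => i _.
under eq_integral do rewrite EFinM.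
rewrite ge0_integralZl ?lee_fin ?H_ge0//; last exact/measurable_EFinP.
rewrite integral_indic// setIT muleC EFinM fineK//.
by rewrite fin_num_measure.
Qed.

Hypothesis H_mono : forall x x' y y' : R, 0 <= x -> x <= x' -> y' <= y -> H x y <= H x' y'.

Variable N : nat -> nat.
Hypothesis N_nd : forall k, ((N k).*2 <= N k.+1)%N.

Lemma grid_funS k w : grid_fun H k (N k) w <= grid_fun H k.+1 (N k.+1) w.
Proof.
have [l u] := grid_indexS k (X_ge0 w).
rewrite {1}/grid_fun; case: ifPn => [iN|_]; last exact: grid_fun_ge0.
have iN' : (grid_index k.+1 (X w) < N k.+1)%N.
  apply: leq_trans (N_nd k); apply: (leq_trans u).
  by rewrite leq_double.
rewrite /grid_fun iN'; apply: H_mono => //.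
  by rewrite meshS mulrA ler_pM2r ?mesh_gt0// -natrM ler_nat muln2.
by rewrite [mesh k]meshS mulrA ler_pM2r ?mesh_gt0// -natrM ler_nat muln2.
Qed.

Lemma grid_sum_nd : nondecreasing_seq (fun k => grid_sum H k (N k)).
Proof.
apply/nondecreasing_seqP => k; rewrite -lee_fin -!integral_grid_fun.
apply: ge0_le_integral => //.
- by move=> w _; rewrite lee_fin grid_fun_ge0.
- by apply/measurable_EFinP; exact: measurable_grid_fun.
- by apply/measurable_EFinP; exact: measurable_grid_fun.
- by move=> w _; rewrite lee_fin grid_funS.
Qed.

Hypothesis H_cvg : forall x (l h : nat -> R),
  l k @[k --> \oo] --> x -> h k @[k --> \oo] --> x ->
  H (l k) (h k) @[k --> \oo] --> H x x.
Hypothesis mH : measurable_fun setT (fun x => H x x).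
Hypothesis N_cover : {ae P, forall w, exists k, X w < (N k)%:R * mesh k}.

Lemma grid_index_cvg x : 0 <= x ->
  ((grid_index k x)%:R * mesh k @[k --> \oo] --> x) /\
  ((grid_index k x).+1%:R * mesh k @[k --> \oo] --> x).
Proof.
move=> x0; have m0 := mesh_cvg0.
split; apply/cvgrPdist_lt => e e0; move/cvgrPdist_lt : m0 => /(_ e e0);
 apply: filterS => k; rewrite sub0r normrN (gtr0_norm (mesh_gt0 k)) => ke;
 have /andP[l u] := grid_index_itv k x0; move: u; rewrite -natr1 mulrDl mul1r => u.
  by rewrite ger0_norm ?subr_ge0//; lra.
by rewrite ltr0_norm ?subr_lt0//; lra.
Qed.

Lemma cover_mono k0 k : (k0 <= k)%N ->
  (N k0)%:R * mesh k0 <= (N k)%:R * mesh k :> R.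
Proof.
elim: k => [|k IH]; first by rewrite leqn0 => /eqP ->.
rewrite leq_eqVlt => /predU1P[->//|k0k]; apply: (le_trans (IH k0k)).
by rewrite [mesh k]meshS mulrA ler_pM2r ?mesh_gt0// -natrM ler_nat muln2.
Qed.

Lemma grid_fun_cvg w : (exists k, X w < (N k)%:R * mesh k) ->
  grid_fun H k (N k) w @[k --> \oo] --> H (X w) (X w).
Proof.
move=> [k0 Xk0]; have [c1 c2] := grid_index_cvg (X_ge0 w).
apply: cvg_trans (H_cvg c1 c2); apply: near_eq_cvg.
exists k0 => // k /= k0k; rewrite /grid_fun ifT//.
by rewrite grid_index_lt// (lt_le_trans Xk0)// cover_mono.
Qed.

(** Monotone convergence, hence valid also when the limit is infinite, as the moment generating
    functions of interest may be. *)
Lemma grid_sum_cvg :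
  (grid_sum H k (N k))%:E @[k --> \oo] --> (\int[P]_w (H (X w) (X w))%:E)%E.
Proof.
under eq_cvg do rewrite -integral_grid_fun.
have mg k : measurable_fun setT (fun w => (grid_fun H k (N k) w)%:E).
  by apply/measurable_EFinP; exact: measurable_grid_fun.
have g0 k w : (0 <= (grid_fun H k (N k) w)%:E)%E by rewrite lee_fin grid_fun_ge0.
have nd w : nondecreasing_seq (fun k => (grid_fun H k (N k) w)%:E).
  by apply/nondecreasing_seqP => k; rewrite lee_fin grid_funS.
have -> : (\int[P]_w (H (X w) (X w))%:E =
    \int[P]_w limn (fun k => (grid_fun H k (N k) w)%:E))%E.
  apply: ge0_ae_eq_integral => //.
  - by apply/measurable_EFinP; apply: (measurableT_comp mH).
  - apply: emeasurable_fun_cvg mg _ => w _.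
    by apply: ereal_nondecreasing_is_cvgn; exact: nd.
  - by move=> w _; rewrite lee_fin H_ge0.
  - move=> w _; apply: lime_ge; first by apply: ereal_nondecreasing_is_cvgn; exact: nd.
    by apply: nearW => k.
  - move: N_cover; apply: filterS => w wN _; apply/esym/cvg_lim => //.
    apply: cvg_EFin; first exact: nearW.
    exact: (grid_fun_cvg wN).
by apply: (@cvg_monotone_convergence _ _ _ P setT measurableT
  (fun k w => (grid_fun H k (N k) w)%:E)) => // w _ m n mn; exact: nd.
Qed.

End DyadicGrid.

(** * Truncation of the service times below the right endpoint *)

Section DyadicWalk.
Context {d : measure_display} {T : measurableType d} {R : realType}.
Variables (P : probability T R) (A B : {RV P >-> R}).
Hypothesis A_ge0 : forall w, 0 <= A w.
Hypothesis B_ge0 : forall w, 0 <= B w.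

(** The cap [4 ^ k] makes a maximum exist for unbounded services; the corresponding level is [2 ^ k]
    and tends to infinity. *)
Let exists_top k : exists M : nat, (M <= 4 ^ k)%N &&
  (0 < P [set w | (M%:R * mesh k <= B w)%R])%E.
Proof.
exists 0%N => /=; rewrite (_ : [set w | _] = setT) ?probability_setT ?lte_fin//.
by apply/seteqP; split => w //= _; rewrite mul0r.
Qed.

Let top_le k M : (M <= 4 ^ k)%N && (0 < P [set w | (M%:R * mesh k <= B w)%R])%E ->
  (M <= 4 ^ k)%N.
Proof. by case/andP. Qed.

(* Services of size at least [top_cell k * mesh k] have positive probability,
   although almost every service is eventually smaller than that. *)
Definition top_cell k := ex_maxn (exists_top k) (@top_le k).

Lemma top_cell_le k : (top_cell k <= 4 ^ k)%N.
Proof. by rewrite /top_cell; case: ex_maxnP => m /andP[]. Qed.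

Lemma top_cell_gt0 k : (0 < P [set w | ((top_cell k)%:R * mesh k <= B w)%R])%E.
Proof. by rewrite /top_cell; case: ex_maxnP => m /andP[]. Qed.

Lemma top_cell_max k M : (top_cell k < M)%N -> (M <= 4 ^ k)%N ->
  P [set w | M%:R * mesh k <= B w] = 0%E.
Proof.
rewrite /top_cell; case: ex_maxnP => m _ mmax mM M4.
apply/eqP; rewrite eq_le measure_ge0 andbT leNgt; apply/negP => P0.
have : (M <= m)%N by apply: mmax; rewrite M4.
by rewrite leqNgt mM.
Qed.

Lemma top_cellS k : ((top_cell k).*2 <= top_cell k.+1)%N.
Proof.
rewrite {2}/top_cell; case: ex_maxnP => m _; apply; apply/andP; split.
  by rewrite expnS -muln2 mulnC (leq_trans (_ : _ <= 2 * 4 ^ k)%N) ?leq_mul2l ?top_cell_le// leq_mul2r orbT.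
have -> : ((top_cell k).*2)%:R * mesh k.+1 = (top_cell k)%:R * mesh k :> R.
  by rewrite [mesh k]meshS -muln2 natrM mulrA.
exact: top_cell_gt0.
Qed.

Lemma pow4_mesh k : (4 ^ k)%:R * mesh k = (2 ^ k)%:R :> R.
Proof.
rewrite /mesh !natrX (_ : 4%:R = 2 * 2 :> R); last by rewrite -natrM.
by rewrite exprMn mulfK// expf_neq0.
Qed.

Lemma pow2_gt (x : R) : exists k0, forall k, (k0 <= k)%N -> x < (2 ^ k)%:R.
Proof.
exists (Num.truncn x).+1 => k k0k; apply: (lt_le_trans (truncnS_gt x)).
by rewrite ler_nat (leq_trans k0k)// ltnW// ltn_expl.
Qed.

Hypothesis B_endpoint : P [set w | (B w)%:E = right_endpoint B] = 0%E.

Let above_endpoint_null : P.-negligible [set w | (right_endpoint B < (B w)%:E)%E].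
Proof.
have [||[x Ex]] : [\/ right_endpoint B = -oo%E, right_endpoint B = +oo%E |
   exists x, right_endpoint B = x%:E].
  by case: (right_endpoint B) => [x| |]; [apply: Or33; exists x|exact: Or32|exact: Or31].
- move=> E; exfalso.
  have : ((- 1)%:E <= right_endpoint B)%E.
    apply: ereal_sup_ubound; exists (-1) => //=.
    rewrite (_ : [set w | _] = setT) ?probability_setT ?lte_fin//.
    apply/seteqP; split => w //= _.
    by rewrite (lt_le_trans _ (B_ge0 w))// oppr_lt0.
  by rewrite E.
- move=> ->; rewrite (_ : [set w | _] = set0); first exact: negligible_set0.
  by apply/seteqP; split => // w; rewrite /= ltNge leey.
rewrite Ex.
apply: (@negligibleS _ _ _ P (\bigcup_n [set w | x + n.+1%:R^-1 < B w])).
  move=> w /=; rewrite lte_fin => xB.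
  have [n _ Hn] : \forall n \near \oo, (n.+1%:R^-1 : R) < B w - x.
    have Bx0 : 0 < B w - x by rewrite subr_gt0.
    have /cvgrPdist_lt/(_ _ Bx0) := @cvg_harmonic R.
    by apply: filterS => n; rewrite /= sub0r normrN ger0_norm ?invr_ge0.
  by exists n => //=; rewrite -ltrBrDl; exact: (Hn n (leqnn n)).
apply: negligible_bigcup => n.
apply/negligibleP; first exact: measurable_set_lt.
apply/eqP; rewrite eq_le measure_ge0 andbT leNgt; apply/negP => P0.
have : ((x + n.+1%:R^-1)%:E <= right_endpoint B)%E by apply: ereal_sup_ubound; exists (x + n.+1%:R^-1).
by rewrite Ex lee_fin gerDl leNgt invr_gt0 ltr0n.
Qed.

(** Suppose [B w] is above all top levels. If some [x > B w] were exceeded by services with positive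
    probability, then on a fine grid the level one mesh higher would still lie below [x], against
    maximality. So [B w] is at least the right endpoint, a null event by [B_endpoint]. *)
Lemma top_cell_cover : {ae P, forall w, exists k, B w < (top_cell k)%:R * mesh k}.
Proof.
have n1 : P.-negligible [set w | (B w)%:E = right_endpoint B].
  apply/negligibleP => //; case: (right_endpoint B) => [c| |].
  - rewrite (_ : [set w | _] = B @^-1` [set c]); first exact: measurable_RV.
    by apply/seteqP; split => w /= => [[]|->].
  - by rewrite (_ : [set w | _] = set0)//; apply/seteqP; split.
  - by rewrite (_ : [set w | _] = set0)//; apply/seteqP; split.
have := negligibleU n1 above_endpoint_null.
apply: negligibleS => w /= nk.
have top k : (top_cell k)%:R * mesh k <= B w.
  by rewrite leNgt; apply/negP => ?; apply: nk; exists k.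
suff : (right_endpoint B <= (B w)%:E)%E.
  by rewrite le_eqVlt => /predU1P[->|]; [left|right].
apply: ge_ereal_sup => _ [x /= Px <-]; rewrite lee_fin leNgt; apply/negP => Bx.
have [k1 Hk1] := pow2_gt (B w).
have /cvgrPdist_lt/(_ (x - B w)) := @mesh_cvg0 R.
rewrite subr_gt0 => /(_ Bx)[k2 _ Hk2].
pose k := maxn k1 k2.
have := Hk2 k (leq_maxr _ _); rewrite /= sub0r normrN (gtr0_norm (mesh_gt0 k)) => mk.
have tk : (top_cell k < 4 ^ k)%N.
  rewrite -(@ltr_nat R) -(ltr_pM2r (mesh_gt0 k)) pow4_mesh.
  by rewrite (le_lt_trans (top k))// Hk1// leq_maxl.
have := top_cell_max (ltnSn _) tk; apply/eqP; rewrite gt_eqF//.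
apply: (lt_le_trans Px); rewrite le_measure ?inE//.
- exact: measurable_set_lt.
- exact: measurable_set_le.
- move=> z /= xz; rewrite -natr1 mulrDl mul1r; have := top k; lra.
Qed.

End DyadicWalk.

(** * Tilted mass and drift of the dyadic walk *)

Section DyadicWalkSpec.
Context {d : measure_display} {T : measurableType d} {R : realType}.
Variables (P : probability T R) (A B : {RV P >-> R}).
Hypothesis A_ge0 : forall w, 0 <= A w.
Hypothesis B_ge0 : forall w, 0 <= B w.
Hypothesis B_endpoint : P [set w | (B w)%:E = right_endpoint B] = 0%E.
Variable theta : R.
Hypothesis theta_gt0 : 0 < theta.

Local Notation N k := (4 ^ k)%N.
Local Notation M k := (top_cell B_ge0 k).

Definition walk_weight k (x : 'I_(N k) * 'I_(M k)) : R :=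
  grid_prob A k x.1 * grid_prob B k x.2.

Definition walk_clock k (x : 'I_(N k) * 'I_(M k)) : R := x.1%:R * mesh k.

(* Services are rounded down and interarrival times are rounded up, so that
   the dyadic walk stays below the actual one. *)
Definition walk_jump k (x : 'I_(N k) * 'I_(M k)) : R :=
  x.2%:R * mesh k - x.1.+1%:R * mesh k.

Definition walk_mass k s : R :=
  \sum_x tilted_weight (@walk_weight k) (@walk_clock k) (@walk_jump k) theta s x.

Let HA s : R -> R -> R := fun x y => expR (theta * x - s * y).
Let HB s : R -> R -> R := fun x _ => expR (s * x).

Lemma walk_weight_ge0 k x : 0 <= @walk_weight k x.
Proof. by rewrite mulr_ge0 ?grid_prob_ge0. Qed.

Lemma walk_massE k s :
  walk_mass k s = grid_sum A (HA s) k (N k) * grid_sum B (HB s) k (M k).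
Proof.
rewrite /walk_mass /grid_sum big_distrlr/= pair_bigA/=; apply: eq_bigr => -[i j] _.
rewrite /tilted_weight /walk_weight /walk_clock /walk_jump/= /HA /HB.
rewrite mulrACA -expRD; congr (_ * expR _); ring.
Qed.

Let NA_double k : ((N k).*2 <= N k.+1)%N.
Proof. by rewrite expnS -muln2 mulnC leq_mul2r orbT. Qed.

Let A_cover : {ae P, forall w, exists k, A w < (N k)%:R * mesh k}.
Proof.
apply: aeW => w; have [k Hk] := pow2_gt (A w).
by exists k; rewrite pow4_mesh Hk.
Qed.

Let HA_ge0 s (x y : R) : 0 <= x -> 0 <= y -> 0 <= HA s x y.
Proof. by move=> _ _; exact: expR_ge0. Qed.

Let HB_ge0 s (x y : R) : 0 <= x -> 0 <= y -> 0 <= HB s x y.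
Proof. by move=> _ _; exact: expR_ge0. Qed.

Let HA_mono s : 0 <= s -> forall x x' y y' : R, 0 <= x -> x <= x' -> y' <= y ->
  HA s x y <= HA s x' y'.
Proof.
move=> s0 x x' y y' x0 xx yy; rewrite ler_expR lerB// ler_wpM2l//.
exact: ltW.
Qed.

Let HB_mono s : 0 <= s -> forall x x' y y' : R, 0 <= x -> x <= x' -> y' <= y ->
  HB s x y <= HB s x' y'.
Proof. by move=> s0 x x' y y' x0 xx yy; rewrite ler_expR ler_wpM2l. Qed.

Lemma grid_sum_ge0 (X : {RV P >-> R}) H k n :
  (forall x y : R, 0 <= x -> 0 <= y -> 0 <= H x y) -> 0 <= grid_sum X H k n.
Proof.
move=> H0; apply: sumr_ge0 => i _; rewrite mulr_ge0 ?grid_prob_ge0//.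
by rewrite H0// mulr_ge0// ltW// mesh_gt0.
Qed.

Lemma walk_mass_le k l s : 0 <= s -> (k <= l)%N -> walk_mass k s <= walk_mass l s.
Proof.
move=> s0 kl; rewrite !walk_massE ler_pM//.
- exact/grid_sum_ge0/HA_ge0.
- exact/grid_sum_ge0/HB_ge0.
- exact: (grid_sum_nd A_ge0 (HA_ge0 s) (HA_mono s0) NA_double kl).
- exact: (grid_sum_nd B_ge0 (HB_ge0 s) (HB_mono s0) (top_cellS B_ge0) kl).
Qed.

Lemma walk_mass_continuous k : continuous (walk_mass k).
Proof.
have := @tilted_sum_continuous R _ (@walk_weight k) (@walk_clock k) (@walk_jump k)
  theta (fun=> 1).
by under eq_fun do under eq_bigr do rewrite mulr1.
Qed.

Let gA_cvg s : 0 <= s ->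
  (grid_sum A (HA s) k (N k))%:E @[k --> \oo] --> 'M_P A (- (s - theta)).
Proof.
move=> s0.
have -> : 'M_P A (- (s - theta)) = (\int[P]_w (HA s (A w) (A w))%:E)%E.
  by rewrite mgfE; apply: eq_integral => w _; rewrite /HA -mulrBl opprB.
apply: (grid_sum_cvg A_ge0 (HA_ge0 s) (HA_mono s0) NA_double) => //.
  move=> x l h lx hx.
  have c : theta * l k - s * h k @[k --> \oo] --> theta * x - s * x.
    by apply: cvgB; apply: cvgM => //; exact: cvg_cst.
  exact: (cvg_comp _ _ c (@continuous_expR R _)).
by apply: measurableT_comp => //; apply: measurable_funB; exact: measurable_funM.
Qed.

Let gB_cvg s : 0 <= s ->
  (grid_sum B (HB s) k (M k))%:E @[k --> \oo] --> 'M_P B s.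
Proof.
move=> s0; rewrite mgfE.
apply: (grid_sum_cvg B_ge0 (HB_ge0 s) (HB_mono s0) (top_cellS B_ge0)) => //.
- move=> x l h lx hx.
  have c : s * l k @[k --> \oo] --> s * x by apply: cvgM => //; exact: cvg_cst.
  exact: (cvg_comp _ _ c (@continuous_expR R _)).
- by apply: measurableT_comp => //; exact: measurable_funM.
- exact: top_cell_cover.
Qed.

Hypothesis mgf_gt1 : forall s, 0 <= s ->
  (1 < 'M_P A (- (s - theta)) * 'M_P B s)%E.

Lemma walk_mass_gt1_at s : 0 <= s -> exists k, 1 < walk_mass k s.
Proof.
move=> s0; have B1 := mgf_ge1 B_ge0 s0.
have A0 : (0 < 'M_P A (- (s - theta)))%E.
  rewrite lt0e mgf_ge0 andbT; apply/eqP => A0.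
  by have := mgf_gt1 s0; rewrite A0 mul0e ltNge lee01.
have dAB : ('M_P A (- (s - theta)) *? 'M_P B s)%E.
  by rewrite neq0_mule_def// gt_eqF// (lt_trans lte01 (mgf_gt1 s0)).
have [k _ Hk] := cvgeM dAB (gA_cvg s0) (gB_cvg s0) (open_ereal_gt' (mgf_gt1 s0)).
exists k; have := Hk k (leqnn k).
by rewrite /= -EFinM -walk_massE lte_fin.
Qed.

Hypothesis A_indep_B : forall E F : set R, measurable E -> measurable F ->
  P (A @^-1` E `&` B @^-1` F) = (P (A @^-1` E) * P (B @^-1` F))%E.
Hypothesis B_gt_A : (0 < P [set w | (A w < B w)%R])%E.

(** Once the mesh is below half of $B-A>0$, a full cell separates the cells of $A$ and $B$. If all
    such pairs of cells had weight zero, $\{A<B\}$ would be covered by countably many null sets. *)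
Lemma walk_jump_gt0 : exists k (x : 'I_(N k) * 'I_(M k)),
  0 < walk_weight x /\ mesh k <= walk_jump x.
Proof.
apply: contrapT => no.
pose cell (X : {RV P >-> R}) k i := X @^-1` `[i%:R * mesh k, i.+1%:R * mesh k[%classic.
(* [i.+2 <= j] because the interarrival time is rounded up to [i.+1] and the jump must be at least
   one mesh. *)
pose C k i j := if (i.+2 <= j)%N && (j < M k)%N then cell A k i `&` cell B k j else set0.
have nC k i j : P.-negligible (C k i j).
  rewrite /C; case: ifPn => [/andP[ij jM]|_]; last exact: negligible_set0.
  apply/negligibleP; first by apply: measurableI; exact: measurable_RV.
  transitivity (P (cell A k i) * P (cell B k j))%E; first exact: A_indep_B.
  rewrite /cell !grid_probE -EFinM; congr (_%:E).
  have iN : (i < N k)%N.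
    by rewrite (leq_trans _ (top_cell_le B_ge0 k))// (leq_ltn_trans _ jM)// ltnW// ltnW.
  apply/eqP; rewrite eq_le mulr_ge0 ?grid_prob_ge0// andbT leNgt; apply/negP => pq.
  apply: no; exists k, (Ordinal iN, Ordinal jM); split => //.
  rewrite /walk_jump/= -mulrBl ler_peMl ?(ltW (mesh_gt0 _))//.
  by rewrite lerBrDr -natr1 addrC natr1 natr1 ler_nat.
have : P [set w | A w < B w] = 0%E.
  apply/negligibleP; first exact: measurable_set_lt.
  apply: (@negligibleS _ _ _ P (~` [set w | exists k, B w < (M k)%:R * mesh k]
     `|` \bigcup_k \bigcup_i \bigcup_j C k i j)); last first.
    apply: negligibleU; first exact: top_cell_cover.
    apply: negligible_bigcup => k; apply: negligible_bigcup => i.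
    exact: negligible_bigcup.
  move=> w /= AB; have [[k1 Bk1]|nk] := pselect (exists k, B w < (M k)%:R * mesh k); [right|by left].
  have AB2 : 0 < (B w - A w) / 2 by rewrite divr_gt0// subr_gt0.
  have /cvgrPdist_lt/(_ _ AB2)[k2 _ Hk2] := @mesh_cvg0 R.
  pose k := maxn k1 k2.
  have := Hk2 k (leq_maxr _ _); rewrite /= sub0r normrN (gtr0_norm (mesh_gt0 k)) => mk.
  have Bk : B w < (M k)%:R * mesh k.
    exact: lt_le_trans Bk1 (cover_mono (top_cellS B_ge0) (leq_maxl _ _)).
  have iA := grid_index_itv k (A_ge0 w); have iB := grid_index_itv k (B_ge0 w).
  exists k => //; exists (grid_index k (A w)) => //; exists (grid_index k (B w)) => //.
  rewrite /C ifT; first by rewrite /cell; split; rewrite /= in_itv.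
  rewrite grid_index_lt// Bk andbT.
  rewrite -ltnS -(@ltr_nat R) -(ltr_pM2r (mesh_gt0 k)) -natr1 -natr1 !mulrDl !mul1r.
  by move: iA iB; rewrite -!natr1 !mulrDl !mul1r; lra.
by apply/eqP; rewrite gt_eqF.
Qed.

Lemma walk_mass_growth : exists k, forall C,
  exists2 S, 0 <= S & forall s, S <= s -> C < walk_mass k s.
Proof.
have [k [x0 [w0 j0]]] := walk_jump_gt0; exists k => C.
have m0 : 0 < mesh k :> R by exact: mesh_gt0.
pose S := `|C| / (walk_weight x0 * mesh k); exists S.
  by rewrite divr_ge0// ltW// mulr_gt0.
move=> s Ss; have s0 : 0 <= s by rewrite (le_trans _ Ss)// divr_ge0// ltW// mulr_gt0.
have : C <= walk_weight x0 * (s * mesh k).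
  rewrite mulrCA (le_trans (ler_norm _))// -ler_pdivrMr// mulr_gt0//.
move=> /le_lt_trans; apply.
rewrite /walk_mass (bigD1 x0)//= ltr_wpDr//.
  by apply: sumr_ge0 => x _; rewrite tilted_weight_ge0//; exact: walk_weight_ge0.
rewrite /tilted_weight ltr_pM2l//.
apply: lt_le_trans (expR_ge1Dx _).
have := ler_wpM2l s0 j0.
have : 0 <= theta * walk_clock x0.
  by rewrite mulr_ge0 ?(ltW theta_gt0)// mulr_ge0// ltW.
by lra.
Qed.

(** Dini's argument: the mass is continuous in [s] and nondecreasing in [k], so a grid good at one
    [s] is good nearby, and so are all finer ones. Beyond [S0], where compactness is lost, the
    growth of one fixed grid takes over. *)
Lemma walk_mass_gt1 : \forall k \near \oo, forall s, 0 <= s -> 1 < walk_mass k s.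
Proof.
have [k0 /(_ 1)[S0 S00 large]] := walk_mass_growth.
have : \forall k \near \oo, `[0, S0]%classic `<=` [set s | 0 <= s -> 1 < walk_mass k s].
  have /compact_near_coveringP := @segment_compact R 0 S0.
  apply => s; rewrite /= in_itv/= => /andP[s0 _].
  have [K HK] := walk_mass_gt1_at s0.
  exists ([set s' | 1 < walk_mass K s'], [set k | (K <= k)%N]) => /=.
    split; last by exists K.
    exact: (cvgr_gt _ (@walk_mass_continuous K s) _ HK).
  by move=> [s' k] /= [H1 Kk] s'0; rewrite (lt_le_trans H1)// walk_mass_le.
move=> small; near=> k => s s0.
have [sS|sS] := leP s S0.
  by apply: (near small k) => //; rewrite /= in_itv/= s0.
rewrite (lt_le_trans (large s (ltW sS)))// walk_mass_le//.
by near: k; exists k0.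
Unshelve. all: by end_near. Qed.

Let sum_le1 (X : {RV P >-> R}) k n : (forall w, 0 <= X w) ->
  \sum_(i < n) grid_prob X k i <= 1.
Proof.
move=> X0.
have -> : \sum_(i < n) grid_prob X k i = grid_sum X (fun _ _ => 1) k n.
  by apply: eq_bigr => i _; rewrite mulr1.
rewrite -lee_fin -integral_grid_fun// -(@probability_setT _ _ _ P) -[leRHS]mul1e -integral_cst//.
apply: ge0_le_integral => //.
- by move=> w _; rewrite lee_fin grid_fun_ge0.
- by apply/measurable_EFinP; exact: measurable_grid_fun.
- by move=> w _; rewrite lee_fin /grid_fun; case: ifP.
Qed.

Lemma walk_weight_le1 k : \sum_x @walk_weight k x <= 1.
Proof.
have -> : \sum_x @walk_weight k x =
    (\sum_(i < N k) grid_prob A k i) * (\sum_(j < M k) grid_prob B k j).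
  by rewrite big_distrlr/= pair_bigA.
by rewrite mulr_ile1 ?sum_le1//; apply: sumr_ge0 => i _; exact: grid_prob_ge0.
Qed.

Hypothesis mean_lt : (\int[P]_w (B w)%:E < \int[P]_w (A w)%:E)%E.

Let Hid : R -> R -> R := fun x _ => x.
Let H1 : R -> R -> R := fun _ _ => 1.

(** Rounding down and truncating keep the mean service below $\mathbb{E}B$, so only the right-hand
    side needs a limit; $\mathbb{E}A$ may be infinite. *)
Lemma untilted_drift : \forall k \near \oo,
  grid_sum B Hid k (M k) < grid_sum B H1 k (M k) * grid_sum A Hid k (N k).
Proof.
have Hid0 (x y : R) : 0 <= x -> 0 <= y -> 0 <= Hid x y by [].
have Hid_mono (x x' y y' : R) : 0 <= x -> x <= x' -> y' <= y -> Hid x y <= Hid x' y' by [].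
have H10 (x y : R) : 0 <= x -> 0 <= y -> 0 <= H1 x y by [].
have cA : (grid_sum A Hid k (N k))%:E @[k --> \oo] --> (\int[P]_w (A w)%:E)%E.
  apply: (grid_sum_cvg A_ge0 Hid0 Hid_mono NA_double) => //.
  exact: measurable_id.
have cB : (grid_sum B H1 k (M k))%:E @[k --> \oo] --> 1%E.
  have -> : 1%E = (\int[P]_w (H1 (B w) (B w))%:E)%E.
    by rewrite -[LHS](@probability_setT _ _ _ P) -[LHS]mul1e -integral_cst.
  apply: (grid_sum_cvg B_ge0 H10 _ (top_cellS B_ge0)) => //.
  - by move=> x l h _ _; exact: cvg_cst.
  - exact: top_cell_cover.
have A0 : (0 <= \int[P]_w (A w)%:E)%E by apply: integral_ge0 => w _; rewrite lee_fin.
have d1 : (1 *? \int[P]_w (A w)%:E)%E.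
  rewrite neq0_mule_def// mul1e gt_eqF// (le_lt_trans _ mean_lt)//.
  by apply: integral_ge0 => w _; rewrite lee_fin.
have mean_lt' : (\int[P]_w (B w)%:E < 1 * \int[P]_w (A w)%:E)%E by rewrite mul1e.
have [K _ HK] := cvgeM d1 cB cA (open_ereal_gt' mean_lt').
exists K => // k Kk; have := HK k Kk; rewrite /= -EFinM.
rewrite -lte_fin; apply: le_lt_trans.
rewrite -integral_grid_fun//.
apply: ge0_le_integral => //.
- by move=> w _; rewrite lee_fin grid_fun_ge0.
- by apply/measurable_EFinP; exact: measurable_grid_fun.
- exact/measurable_EFinP.
- move=> w _; rewrite lee_fin /grid_fun; case: ifP => // _.
  by have /andP[] := grid_index_itv k (B_ge0 w).
Qed.

(** At [s = 0] the factor $e^{\theta a}$ is still there. It increases with the interarrival time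
    while the mean jump decreases, so, as in Chebyshev's association inequality, it can only favour
    a negative drift. *)
Lemma walk_drift : \forall k \near \oo,
  \sum_x tilted_weight (@walk_weight k) (@walk_clock k) (@walk_jump k) theta 0 x
    * walk_jump x < 0.
Proof.
have := untilted_drift; apply: filterS => k.
set bbar := grid_sum B Hid k _; set Q := grid_sum B H1 k _ => drift.
have b0 : 0 <= bbar by apply: grid_sum_ge0.
have a0 : 0 <= grid_sum A Hid k (N k) by apply: grid_sum_ge0.
have Q0 : 0 < Q.
  have Q0 : 0 <= Q by apply: grid_sum_ge0.
  rewrite lt0r Q0 andbT; apply/eqP => Q0'.
  by move: drift; rewrite Q0' mul0r ltNge b0.
pose lo i : R := i%:R * mesh k; pose hi i : R := i.+1%:R * mesh k.
have -> : \sum_x tilted_weight (@walk_weight k) (@walk_clock k) (@walk_jump k) theta 0 x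
    * walk_jump x =
    \sum_(i < N k) grid_prob A k i * (expR (theta * lo i) * (bbar - Q * hi i)).
  rewrite -(pair_bigA _ (fun i j => tilted_weight (@walk_weight k) (@walk_clock k)
    (@walk_jump k) theta 0 (i, j) * walk_jump (i, j)))/=.
  apply: eq_bigr => i _; rewrite /bbar /Q /grid_sum mulr_suml -sumrB !mulr_sumr.
  apply: eq_bigr => j _; rewrite /tilted_weight /walk_weight /walk_jump /walk_clock/=.
  by rewrite /Hid /H1 /lo /hi mul0r addr0; ring.
(* The clock value at which the mean jump changes sign: on either side of it, replacing the
   exponential factor by its value at [c] increases the term. *)
pose c := bbar / Q - mesh k.
have key i : expR (theta * lo i) * (bbar - Q * hi i) <=
    expR (theta * c) * (bbar - Q * hi i).
  have hl : hi i = lo i + mesh k by rewrite /hi /lo -natr1 mulrDl mul1r.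
  have E : bbar - Q * hi i = Q * (c - lo i).
    rewrite /c hl mulrBr; field; exact: lt0r_neq0.
  rewrite E; have [lc|cl] := leP (lo i) c.
    by rewrite ler_wpM2r ?mulr_ge0 ?subr_ge0 ?(ltW Q0)// ler_expR ler_wpM2l ?(ltW theta_gt0).
  rewrite ler_wnM2r ?mulr_ge0_le0 ?(ltW Q0) ?subr_le0 ?(ltW cl)//.
  by rewrite ler_expR ler_wpM2l ?(ltW theta_gt0) ?(ltW cl).
apply: (@le_lt_trans _ _ (\sum_(i < N k) grid_prob A k i *
   (expR (theta * c) * (bbar - Q * hi i)))).
  by apply: ler_sum => i _; rewrite ler_wpM2l ?grid_prob_ge0.
have -> : \sum_(i < N k) grid_prob A k i * (expR (theta * c) * (bbar - Q * hi i)) =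
   expR (theta * c) * (bbar * (\sum_(i < N k) grid_prob A k i)
      - Q * \sum_(i < N k) grid_prob A k i * hi i).
  rewrite !mulr_sumr -sumrB mulr_sumr; apply: eq_bigr => i _; ring.
rewrite pmulr_rlt0 ?expR_gt0// subr_lt0.
apply: (@le_lt_trans _ _ bbar).
  by rewrite ler_piMr// sum_le1.
apply: (lt_le_trans drift); rewrite ler_wpM2l ?(ltW Q0)//.
apply: ler_sum => i _; rewrite ler_wpM2l ?grid_prob_ge0//.
by rewrite /Hid /hi ler_wpM2r ?(ltW (mesh_gt0 _))// ler_nat.
Qed.

(** The positive drift comes from convexity: the tilted drift is the derivative of the mass in [s],
    and the mass at a large [S] exceeds that at 0. Term by term this is $e^t-1\le te^t$. *)
Lemma dyadic_walk_spec : exists k,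
  [/\ forall s, 0 <= s -> 1 < \sum_x
        tilted_weight (@walk_weight k) (@walk_clock k) (@walk_jump k) theta s x,
      \sum_x tilted_weight (@walk_weight k) (@walk_clock k) (@walk_jump k) theta 0 x
        * walk_jump x < 0 &
      exists2 s, 0 <= s & 0 < \sum_x
        tilted_weight (@walk_weight k) (@walk_clock k) (@walk_jump k) theta s x
        * walk_jump x].
Proof.
have [k0 growth] := walk_mass_growth.
have [k [mass drift k0k]] : exists k, [/\ forall s, 0 <= s -> 1 < walk_mass k s,
   \sum_x tilted_weight (@walk_weight k) (@walk_clock k) (@walk_jump k) theta 0 x
        * walk_jump x < 0 & (k0 <= k)%N].
  near \oo%N => k; exists k; split; near: k.
  - exact: walk_mass_gt1.
  - exact: walk_drift.
  - by exists k0.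
exists k; split => //.
have [S S0 /(_ _ (lexx S)) HS] := growth (walk_mass k 0).
exists S => //.
have lt0S : walk_mass k 0 < walk_mass k S by rewrite (lt_le_trans HS)// walk_mass_le.
have Sp : 0 < S.
  by rewrite lt0r S0 andbT; apply: contraTneq lt0S => ->; rewrite ltxx.
suff : walk_mass k S - walk_mass k 0 <= S * \sum_x
    tilted_weight (@walk_weight k) (@walk_clock k) (@walk_jump k) theta S x * walk_jump x.
  move=> H; rewrite -(pmulr_rgt0 _ Sp) (lt_le_trans _ H)// subr_gt0//.
rewrite mulr_sumr -sumrB; apply: ler_sum => x _.
set t := S * walk_jump x.
have -> : tilted_weight (@walk_weight k) (@walk_clock k) (@walk_jump k) theta S x -
    tilted_weight (@walk_weight k) (@walk_clock k) (@walk_jump k) theta 0 x =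
    walk_weight x * expR (theta * walk_clock x) * (expR t - 1).
  by rewrite /tilted_weight mul0r addr0 -/t expRD; ring.
have -> : S * (tilted_weight (@walk_weight k) (@walk_clock k) (@walk_jump k) theta S x *
    walk_jump x) = walk_weight x * expR (theta * walk_clock x) * (expR t * t).
  by rewrite /tilted_weight -/t expRD /t; ring.
apply: ler_wpM2l; first exact: mulr_ge0 (walk_weight_ge0 x) (expR_ge0 _).
have := ler_wpM2l (expR_ge0 t) (expR_ge1Dx (- t)).
by rewrite expRN mulfV ?gt_eqF ?expR_gt0//; lra.
Unshelve. all: by end_near. Qed.

End DyadicWalkSpec.

(** * Lower bound *)

Lemma sum_nat_shift (R : realType) (F : nat -> R) (p : pred nat) n j :
  \sum_(n <= i < n + j | p i) F i = \sum_(s < j | p (n + s)%N) F (n + s)%N.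
Proof.
rewrite -{1}[n]add0n big_addn addKn big_mkord.
by apply: eq_big => s; rewrite addnC.
Qed.

Lemma sum_measure_le {d : measure_display} {T : measurableType d} {R : realType}
    (P : probability T R) (I : finType) (F : I -> set T) (G : set T) :
  (forall i, measurable (F i)) -> measurable G -> (forall i, F i `<=` G) ->
  (forall i j w, F i w -> F j w -> i = j) -> (\sum_i P (F i) <= P G)%E.
Proof.
move=> mF mG FG disj.
have mU (s : seq I) : measurable (\big[setU/set0]_(i <- s) F i).
  exact: bigsetU_measurable.
have -> : (\sum_i P (F i) = P (\big[setU/set0]_(i <- index_enum I) F i))%E.
  have := index_enum_uniq I; elim: (index_enum I) => [_|i s IH /= /andP[iS us]].
    by rewrite !big_nil measure0.
  rewrite !big_cons measureU//; last first.
    apply/seteqP; split => // w [Fi]; rewrite -bigcup_seq => -[j /= js Fj].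
    by move: iS; rewrite (disj i j w Fi Fj) js.
  by rewrite IH.
rewrite le_measure ?inE//.
by rewrite -bigcup_seq => w [i _ Fi]; exact: FG Fi.
Qed.

Section LowerBound.
Context {R : realType} {d : measure_display} {T : measurableType d}.
Variables (P : probability T R) (A B : nat -> {RV P >-> R}).
Hypothesis A_ge0 : forall n w, 0 <= A n w.
Hypothesis B_ge0 : forall n w, 0 <= B n w.
Hypothesis A_same_law : forall n, same_law (A n) (A 0%N).
Hypothesis B_same_law : forall n, same_law (B n) (B 0%N).
Hypothesis AB_independent : mutually_independent
  (fun i : nat + nat => match i with inl n => A n | inr n => B n end).

Let X (i : nat + nat) : {RV P >-> R} := match i with inl n => A n | inr n => B n end.

Let index (i : nat + nat) : nat := match i with inl n => n | inr n => n end.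

(* From customer [n] on, a backlog [y] of small work lasts until the clock
   exceeds [x], all customers arriving meanwhile being smaller than [b]. *)
Definition backlog_lasts (b x y : R) (n : nat) (w : T) : Prop :=
  exists l, [/\ x < \sum_(t < l) A (n + t)%N w,
    forall j, (j <= l)%N -> 0 <= y + \sum_(t < j) (B (n + t)%N w - A (n + t)%N w) &
    forall t, (t < l)%N -> B (n + t)%N w < b].

Variables k N M : nat.

Let cell i : set R := `[i%:R * mesh k, i.+1%:R * mesh k[%classic.

Let weight (x : 'I_N * 'I_M) : R := grid_prob (A 0%N) k x.1 * grid_prob (B 0%N) k x.2.
Let clock (x : 'I_N * 'I_M) : R := x.1%:R * mesh k.
Let jump (x : 'I_N * 'I_M) : R := x.2%:R * mesh k - x.1.+1%:R * mesh k.

Let cell_probA n i : P (A n @^-1` cell i) = (grid_prob (A 0%N) k i)%:E.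
Proof.
have mc : measurable (cell i) by exact: measurable_itv.
by rewrite -grid_probE; exact: (A_same_law n mc).
Qed.

Let cell_probB n i : P (B n @^-1` cell i) = (grid_prob (B 0%N) k i)%:E.
Proof.
have mc : measurable (cell i) by exact: measurable_itv.
by rewrite -grid_probE; exact: (B_same_law n mc).
Qed.

Let cell_inj i j x : cell i x -> cell j x -> i = j.
Proof.
rewrite /cell/= !in_itv/= => /andP[i1 i2] /andP[j1 j2].
have m0 := mesh_gt0 k : 0 < mesh k :> R.
have := le_lt_trans i1 j2; have := le_lt_trans j1 i2.
rewrite !ltr_pM2r// !ltr_nat !ltnS => ji ij.
by apply/eqP; rewrite eqn_leq ij ji.
Qed.

(** The past is carried along as the event given by [J] and [E]. One step of the walk adds the cells
    of [A n] and [B n] to it: independence multiplies its probability by the step weight, and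
    disjointness of the cells lets the contributions be added. *)
Lemma survival_le_prob (Tgt : set T) K n (J : seq (nat + nat)) E x y :
  measurable Tgt -> uniq J -> (forall i, i \in J -> (index i < n)%N) ->
  (forall i, measurable (E i)) ->
  (forall w, joint_event X J E w -> backlog_lasts (M%:R * mesh k) x y n w -> Tgt w) ->
  (P (joint_event X J E) * (survival weight clock jump K x y)%:E <=
   P (Tgt `&` joint_event X J E))%E.
Proof.
move=> mTgt; elim: K n J E x y => [|K IH] n J E x y uJ Jn mE H.
  rewrite /=; case: ltP => y0; first by rewrite mule0.
  case: ltP => x0; last by rewrite mule0.
  rewrite mule1 le_measure ?inE//; [exact: measurable_joint_event| |].
    by apply: measurableI => //; exact: measurable_joint_event.
  move=> w Jw; split => //; apply: H => //.
  exists 0%N; split => //; first by rewrite big_ord0.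
  by move=> j; rewrite leqn0 => /eqP ->; rewrite big_ord0 addr0.
rewrite /=; case: ltP => y0; first by rewrite mule0.
case: ltP => x0.
  rewrite mule1 le_measure ?inE//; [exact: measurable_joint_event| |].
    by apply: measurableI => //; exact: measurable_joint_event.
  move=> w Jw; split => //; apply: H => //.
  exists 0%N; split => //; first by rewrite big_ord0.
  by move=> j; rewrite leqn0 => /eqP ->; rewrite big_ord0 addr0.
pose E' (e : 'I_N * 'I_M) i := if i == inl n then cell e.1 else
  if i == inr n then cell e.2 else E i.
pose J' := [:: inl n, inr n & J].
have mE' e i : measurable (E' e i).
  rewrite /E'; case: (i == inl n); first exact: measurable_itv.
  by case: (i == inr n); [exact: measurable_itv|exact: mE].
have nJ : inl n \notin J /\ inr n \notin J.
  by split; apply/negP => /Jn /=; rewrite ltnn.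
have neJ i : i \in J -> (i == inl n) = false /\ (i == inr n) = false.
  by move=> iJ; split; apply: contraTF iJ => /eqP ->; [exact: nJ.1|exact: nJ.2].
have E'J e i : i \in J -> E' e i = E i.
  by move=> /neJ[n1 n2]; rewrite /E' n1 n2.
have uJ' : uniq J' by rewrite /= inE negb_or/= nJ.1 nJ.2.
have J'E e : joint_event X J' (E' e) =
    A n @^-1` cell e.1 `&` (B n @^-1` cell e.2 `&` joint_event X J E).
  rewrite !joint_event_cons ?inE ?negb_or ?nJ.1 ?nJ.2//.
  rewrite {1 2}/E' !eqxx/=; congr (_ `&` (_ `&` _)).
  by apply/seteqP; split => w Hw i iJ; have := Hw i iJ; rewrite E'J.
have PJ' e : P (joint_event X J' (E' e)) = ((weight e)%:E * P (joint_event X J E))%E.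
  have -> : P (joint_event X J' (E' e)) = (\prod_(i <- J') P (X i @^-1` E' e i))%E.
    exact: (AB_independent uJ' (mE' e)).
  have -> : P (joint_event X J E) = (\prod_(i <- J) P (X i @^-1` E i))%E.
    exact: (AB_independent uJ mE).
  rewrite !big_cons (eq_big_seq (fun i => P (X i @^-1` E i))); last first.
    by move=> i iJ; rewrite E'J.
  have -> : E' e (inl n) = cell e.1 by rewrite /E' eqxx.
  have -> : E' e (inr n) = cell e.2 by rewrite /E' eqxx.
  by rewrite cell_probA cell_probB muleA -EFinM.
have mJE := measurable_joint_event X J mE.
have Pfin : P (joint_event X J E) = (fine (P (joint_event X J E)))%:E.
  by rewrite fineK// fin_num_measure.
apply: (@le_trans _ _ (\sum_e P (Tgt `&` joint_event X J' (E' e)))%E); last first.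
  apply: sum_measure_le.
  - by move=> e; apply: measurableI => //; exact: measurable_joint_event.
  - exact: measurableI.
  - by move=> e w; rewrite J'E => -[Tw [_ [_ Jw]]].
  - move=> [i j] [i' j'] w; rewrite !J'E /= => -[_ [Ai [Bj _]]] [_ [Ai' [Bj' _]]].
    by congr (_, _); apply: val_inj; [exact: cell_inj Ai Ai'|exact: cell_inj Bj Bj'].
rewrite Pfin -EFinM mulr_sumr -sumEFin; apply: lee_sum => e _.
rewrite mulrCA mulrA EFinM EFinM -Pfin -PJ'.
apply: (IH n.+1) => //.
  move=> i; rewrite !inE => /predU1P[->//|/predU1P[->//|iJ]].
  by rewrite ltnS ltnW// Jn.
move=> w; rewrite J'E => -[]; rewrite /cell /= in_itv/= => /andP[A1 A2].
move=> []; rewrite in_itv/= => /andP[B1 B2] Jw [l [tl wl bl]].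
apply: H => //; exists l.+1; split.
- rewrite big_ord_recl addn0.
  under eq_bigr do rewrite /bump/= addnCA add1n -addSn.
  by move: tl; rewrite /clock; lra.
- move=> [_|j]; first by rewrite big_ord0 addr0.
  rewrite ltnS => /wl; rewrite big_ord_recl addn0.
  under [in X in _ -> X]eq_bigr do rewrite /bump/= addnCA add1n -addSn.
  by rewrite /jump; lra.
- move=> [_|t]; last by rewrite ltnS addnS -addSn; exact: bl.
  rewrite addn0 (lt_le_trans B2)// ler_pM2r ?mesh_gt0// ler_nat.
  exact: ltn_ord.
Qed.

Variable r : T -> nat -> R -> R.
Hypothesis r_srpt : {ae P, forall w, preemptive_srpt (A ^~ w) (B ^~ w) (r w)}.
Variable V : nat -> {RV P >-> R}.
Hypothesis V_sojourn : forall n,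
  {ae P, forall w, (V n w)%:E = sojourn_time (A ^~ w) (r w) n}.

(** The work of customer [n] does not count towards keeping the server busy with smaller customers;
    the earlier ones must therefore leave a backlog covering [A n w] in addition to [y]. *)
Lemma backlog_sojourn w m n (x y : R) :
  preemptive_srpt (A ^~ w) (B ^~ w) (r w) -> (m <= n)%N -> 0 < M%:R * mesh k :> R ->
  M%:R * mesh k <= B n w ->
  (forall i, (m <= i < n)%N -> B i w < M%:R * mesh k) ->
  y + A n w <= \sum_(m <= i < n) (B i w - A i w) ->
  backlog_lasts (M%:R * mesh k) x y n.+1 w ->
  (x%:E < sojourn_time (A ^~ w) (r w) n)%E.
Proof.
move=> srpt mn M0 Bn small start [l [xl backlog later]].
have Aw i : 0 <= A i w by [].
have Bw i : 0 <= B i w by [].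
pose t := arrival_time (A ^~ w).
have nl : (n < n.+1 + l)%N by rewrite leq_addr.
have clockE j : t (n.+1 + j)%N - t n = A n w + \sum_(s < j) A (n.+1 + s)%N w.
  rewrite arrival_time_sub; last by rewrite (leq_trans (leqnSn n))// leq_addr.
  rewrite big_ltn ?leq_addr//; congr (_ + _).
  exact: (sum_nat_shift _ xpredT).
have not_served := @tagged_not_served R (A ^~ w) (B ^~ w) (r w) Aw Bw srpt
  m n (n.+1 + l) (M%:R * mesh k) mn nl.
have rn u : t n <= u -> u <= t (n.+1 + l)%N -> r w n u = B n w.
  apply: not_served => //.
  - move=> i /andP[mi iN] ine; have [ilt|nle] := ltnP i n.
      by apply: small; rewrite mi.
    have ni : (n < i)%N by rewrite ltn_neqAle eq_sym ine.
    by rewrite -(subnKC ni); apply: later; rewrite ltn_subLR.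
  - move=> j /andP[nj jN].
    have -> : j.+1 = (n.+1 + (j - n))%N by rewrite addSn subnKC.
    set s := (j - n)%N.
    have sl : (s <= l)%N by rewrite leq_subLR -ltnS -addSn.
    have := backlog s sl; rewrite sumrB.
    have -> : t (n.+1 + s)%N - t m = \sum_(m <= i < n) A i w + (A n w + \sum_(q < s) A (n.+1 + q)%N w).
      by rewrite -clockE -(arrival_time_sub (A ^~ w) mn) /t; lra.
    have -> : \sum_(m <= i < n.+1 + s | i != n) B i w =
       \sum_(m <= i < n) B i w + \sum_(q < s) B (n.+1 + q)%N w.
      rewrite (@big_cat_nat _ _ _ n)//=; last by rewrite (leq_trans (leqnSn n))// leq_addr.
      congr (_ + _).
        rewrite big_nat_cond [RHS]big_nat_cond; apply: eq_bigl => i.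
        by rewrite andbT; apply: andb_idr => /andP[_ /ltn_eqF ->].
      rewrite big_ltn_cond ?leq_addr// eqxx/=.
      rewrite sum_nat_shift; apply: eq_bigl => q.
      by rewrite gtn_eqF// addSn ltnS leq_addr.
    by move: start; rewrite sumrB; lra.
apply: (@lt_le_trans _ _ (t (n.+1 + l)%N - t n)%:E).
  by rewrite lte_fin clockE; have := Aw n; lra.
apply: sojourn_time_ge => u nu ul.
by rewrite rn// ?(ltW ul)// gt_eqF// (lt_le_trans M0).
Qed.

Variable theta : R.
Variables (i0 : 'I_N) (j0 : 'I_M).
Hypothesis w_gt0 : 0 < weight (i0, j0).
Hypothesis jump_gt0 : 0 < jump (i0, j0).
Hypothesis top_gt0 : (0 < P [set w | (M%:R * mesh k <= B 0%N w)%R])%E.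
Hypothesis survival_bound : exists c y : R, [/\ 0 < c, 0 <= y &
  forall x : R, 0 <= x -> exists K, c * expR (- theta * x) <=
    survival weight clock jump K x y].

(** A favourable past of fixed cost: [h] customers in the cells [i0], [j0] build up the backlog,
    then customer [n] is large and its next interarrival time lies in cell [i0]. The probability of
    this past enters the constant; [h <= n] leaves room for it. *)
Lemma sojourn_tail_lower : exists (c : R) (h : nat), 0 < c /\ forall n (x : R), (h <= n)%N -> 0 <= x ->
  ((c * expR (- theta * x))%:E <= P [set w | (x < V n w)%R])%E.
Proof.
have [c [y [c0 y0 surv]]] := survival_bound.
have m0 : 0 < mesh k :> R by exact: mesh_gt0.
(* Enough positive jumps to reach [y] plus the upper end of cell [i0], which bounds the interarrival
   time after [n]. *)
pose h := (Num.truncn ((y + i0.+1%:R * mesh k) / jump (i0, j0))).+1.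
have hj : y + i0.+1%:R * mesh k <= h%:R * jump (i0, j0).
  by rewrite -ler_pdivrMr// ltW// truncnS_gt.
pose p := grid_prob (A 0%N) k i0; pose q := grid_prob (B 0%N) k j0.
pose u := fine (P [set w | M%:R * mesh k <= B 0%N w]).
have p0 : 0 < p.
  by rewrite lt0r grid_prob_ge0 andbT; apply: contraTneq w_gt0 => p0; rewrite /weight/= -/p p0 mul0r ltxx.
have q0 : 0 < q.
  by rewrite lt0r grid_prob_ge0 andbT; apply: contraTneq w_gt0 => q0; rewrite /weight/= -/q q0 mulr0 ltxx.
have mtop : measurable [set w | M%:R * mesh k <= B 0%N w] by exact: measurable_set_le.
have u0 : 0 < u by rewrite fine_gt0// top_gt0/= ltey_eq fin_num_measure.
have pqu0 : 0 < p ^+ h.+1 * (q ^+ h * u).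
  by apply: mulr_gt0; [exact: exprn_gt0|apply: mulr_gt0 => //; exact: exprn_gt0].
exists (c * (p ^+ h.+1 * (q ^+ h * u))), h; split; first exact: mulr_gt0.
move=> n x hn x0.
pose m := (n - h)%N.
pose E (i : nat + nat) : set R := match i with
  | inl _ => cell i0
  | inr i => if i == n then `[M%:R * mesh k, +oo[%classic else cell j0 end.
pose J : seq (nat + nat) := [seq inl i | i <- index_iota m n.+1] ++
   [seq inr i | i <- index_iota m n.+1].
have uJ : uniq J.
  rewrite cat_uniq !map_inj_uniq ?iota_uniq ?andbT/=; [|by move=> ? ? []..].
  by apply/hasPn => _ /mapP[i _ ->]; apply/negP => /mapP[].
have JE i : i \in J -> (m <= index i < n.+1)%N.
  by rewrite mem_cat => /orP[] /mapP[z + ->] /=; rewrite mem_index_iota.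
have mE i : measurable (E i).
  by case: i => [i|i] /=; [|case: (i == n)]; exact: measurable_itv.
have PJ : P (joint_event X J E) = (p ^+ h.+1 * (q ^+ h * u))%:E.
  rewrite /joint_event AB_independent//.
  rewrite big_cat !big_map/=.
  have -> : (\prod_(i <- index_iota m n.+1) P (A i @^-1` cell i0) = (p ^+ h.+1)%:E)%E.
    under eq_bigr do rewrite cell_probA.
    by rewrite prodEFin prodr_const_nat /m subSn ?leq_subr// subKn.
  rewrite [RHS]EFinM; congr (_ * _)%E.
  rewrite big_nat_recr ?leq_subr//= eqxx [RHS]EFinM.
  have -> : P (B n @^-1` `[M%:R * mesh k, +oo[%classic) = u%:E.
    have -> : P (B n @^-1` `[M%:R * mesh k, +oo[%classic) =
        P (B 0%N @^-1` `[M%:R * mesh k, +oo[%classic).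
      have mI : measurable (`[M%:R * mesh k, +oo[%classic : set R) by exact: measurable_itv.
      exact: (B_same_law n mI).
    rewrite /u fineK ?fin_num_measure//; congr (P _).
    by apply/seteqP; split => w; rewrite /= in_itv/= andbT.
  congr (_ * _)%E.
  transitivity (\prod_(m <= i < n) q%:E)%E.
    rewrite big_nat_cond [RHS]big_nat_cond; apply: eq_bigr => i /andP[/andP[_ ilt] _].
    by rewrite ltn_eqF// cell_probB.
  by rewrite prodEFin prodr_const_nat /m subKn.
have [Z [mZ Z0 subZ]] := filterI r_srpt (V_sojourn n).
have mV : measurable [set w | x < V n w] by exact: measurable_set_lt.
(* [survival_le_prob] asks for an inclusion at every sample point, so the target is enlarged by the
   null set [Z] on which the path may violate the dynamics. *)
have mT : measurable ([set w | x < V n w] `|` Z) by exact: measurableU.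
have [K survK] := surv x x0.
have M0 : (0 < M)%N by rewrite (leq_ltn_trans _ (ltn_ord j0)).
have MM : 0 < M%:R * mesh k :> R by rewrite mulr_gt0// ltr0n.
have Jmem i : (m <= i < n.+1)%N -> inl i \in J /\ inr i \in J.
  move=> hi; rewrite !mem_cat; split; apply/orP; [left|right];
  by apply/mapP; exists i => //; rewrite mem_index_iota.
have := @survival_le_prob _ K n.+1 J E x y mT uJ (fun i iJ => proj2 (andP (JE i iJ))) mE.
move=> /(_ _)/le_trans H.
apply: (@le_trans _ _ (P ([set w | x < V n w] `|` Z))); last first.
  apply: (le_trans (measureU2 _ mV mZ)).
  by rewrite [X in (_ + X)%E]Z0 adde0.
apply: (@le_trans _ _ (P (joint_event X J E) * (survival weight clock jump K x y)%:E)%E).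
  rewrite PJ -EFinM lee_fin mulrAC mulrC.
  by rewrite ler_wpM2l// ltW.
apply: H; last first.
  apply: le_measure; rewrite ?inE; [|exact: mT|by move=> w []].
  by apply: measurableI => //; exact: measurable_joint_event.
move=> w Jw lasts; have [wZ|wZ] := pselect (Z w); [by right|left].
have [srpt Vw] : preemptive_srpt (A ^~ w) (B ^~ w) (r w) /\
    (V n w)%:E = sojourn_time (A ^~ w) (r w) n.
  by apply: contrapT => nh; apply: wZ; exact: subZ.
rewrite /= -lte_fin Vw.
have mn : (m <= n)%N by exact: leq_subr.
have Acell i : (m <= i < n.+1)%N -> A i w < i0.+1%:R * mesh k.
  by move=> /Jmem[/Jw]; rewrite /E/cell/= in_itv/= => /andP[].
have Bcell i : (m <= i < n)%N -> j0%:R * mesh k <= B i w < j0.+1%:R * mesh k.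
  move=> /andP[mi iN]; have /Jmem[_ /Jw] : (m <= i < n.+1)%N by rewrite mi ltnW.
  by rewrite /E/cell/= ltn_eqF//= in_itv.
apply: (@backlog_sojourn w m n x y srpt mn MM) => //.
- have /Jmem[_ /Jw] : (m <= n < n.+1)%N by rewrite mn ltnS leqnn.
  by rewrite /E/= eqxx/= in_itv/= andbT.
- move=> i /Bcell/andP[_ /lt_le_trans]; apply.
  by rewrite ler_pM2r// ler_nat.
have sum_ge : h%:R * jump (i0, j0) <= \sum_(m <= i < n) (B i w - A i w).
  have -> : h%:R * jump (i0, j0) = \sum_(m <= i < n) jump (i0, j0).
    by rewrite sumr_const_nat subKn// mulr_natl.
  apply: ler_sum_nat => i hi.
  have /andP[mi iN] := hi; have /andP[b1 _] := Bcell i hi.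
  have := Acell i; rewrite mi ltnW// => /(_ isT) a1.
  by rewrite /jump/= lerB// ltW.
have an : A n w < i0.+1%:R * mesh k by apply: Acell; rewrite mn ltnS leqnn.
by rewrite (le_trans _ sum_ge)// (le_trans _ hj)// lerD2l ltW.
Qed.

End LowerBound.

(** * From the sojourn times to the steady state *)

Section ContinuityPoints.
Context {d : measure_display} {T : measurableType d} {R : realType}.
Variables (Q : probability T R) (Y : {RV Q >-> R}).

(** A monotone function has countably many discontinuities, too few to fill an interval of positive
    length. Convergence in law is available only at such points. *)
Lemma cdf_continuity_point (a b : R) : a < b ->
  exists x, [/\ a < x, x < b & {for x, continuous (cdf Y)}].
Proof.
move=> ab.
pose F x := fine (cdf Y x).
have Ffin x : cdf Y x \is a fin_num by rewrite fin_num_measure.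
have FE x : cdf Y x = (F x)%:E by rewrite /F fineK.
have ndF : nondecreasing_fun F.
  by move=> x y xy; rewrite fine_le// cdf_nondecreasing.
have cD := @discontinuity_countable R a b F (fun x y _ _ => @ndF x y).
have [x xab nD] : exists2 x, a < x < b & ~ discontinuity F x.
  apply: contrapT => no.
  have : countable `]a, b[%classic.
    apply: sub_countable cD; apply: subset_card_le => x /= xab; split => //.
    by apply: contrapT => nD; apply: no; exists x => //; move: xab; rewrite in_itv.
  move=> /countable_lebesgue_measure0; rewrite lebesgue_measure_itv/= lte_fin ab.
  by move=> /eqP; rewrite -EFinB eqe subr_eq0 gt_eqF.
move: xab => /andP[ax xb]; exists x; split => //.
have Fr : F z @[z --> x^'+] --> F x.
  apply: fine_cvg; rewrite fineK//; exact: cdf_right_continuous.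
have cl : cvg (F z @[z --> x^'-]).
  apply: nondecreasing_at_left_is_cvgr.
    by apply: nearW => z y y' _ _; exact: ndF.
  by apply: nearW => z; exists 1 => _ [y _ <-]; rewrite -lee_fin -FE cdf_le1.
have El : lim (F z @[z --> x^'-]) = F x.
  apply: contrapT => ne; apply: nD; split => //; first by apply/cvg_ex; exists (F x).
  by rewrite (cvg_lim _ Fr)//; exact/eqP.
have Fc : {for x, continuous F}.
  apply/left_right_continuousP; split => //.
  by rewrite -El.
have -> : cdf Y = EFin \o F by apply/funext => z; rewrite /= -FE.
by apply: continuous_comp => //; exact: EFin_continuous.
Qed.

Lemma tail_cdf x : Q [set w | x < Y w] = (1 - cdf Y x)%E.
Proof.
rewrite -(cdf_ccdf_1 Y x) addeAC subee ?add0e; last by rewrite fin_num_measure.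
rewrite /ccdf /distribution /pushforward; congr (Q _).
by apply/seteqP; split => w /=; rewrite in_itv/= andbT.
Qed.

End ContinuityPoints.

(** * Logarithmic asymptotics from exponential tail bounds *)

Section LogarithmicAsymptotics.
Context {R : realType}.

Lemma near_pinfty_ratio (D e : R) : 0 < e -> \forall x \near +oo, 0 < x /\ `|D| / x < e.
Proof.
move=> e0; near=> x.
have x0 : 0 < x by near: x; exact: nbhs_pinfty_gt.
split => //; rewrite ltr_pdivrMr// mulrC -ltr_pdivrMr//.
by near: x; apply: nbhs_pinfty_gt; rewrite num_real.
Unshelve. all: by end_near. Qed.

Variable q : R -> \bar R.
Hypothesis q_ge0 : forall x, (0 <= q x)%E.

Let rate x := ((x^-1)%:E * lne (q x))%E.

Lemma log_tail_upper (C kappa t : R) : 0 < C -> - kappa < t ->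
  (forall x, 1 <= x -> (q x <= (C * expR (- kappa * x))%:E)%E) ->
  \forall x \near +oo, (rate x <= t%:E)%E.
Proof.
move=> C0 kt H; near=> x.
have x1 : 1 <= x by near: x; apply: nbhs_pinfty_ge; rewrite num_real.
have x0 : 0 < x by rewrite (lt_le_trans ltr01).
have Ce0 : 0 < C * expR (- kappa * x) by rewrite mulr_gt0// expR_gt0.
have lq : (lne (q x) <= (ln C - kappa * x)%:E)%E.
  have -> : (ln C - kappa * x)%:E = lne (C * expR (- kappa * x))%:E.
    by rewrite lne_EFin// lnM ?posrE ?expR_gt0// expRK mulNr.
  by rewrite lee_lne ?H// in_itv/= leey andbT ?q_ge0// lee_fin ltW.
apply: (@le_trans _ _ (x^-1 * (ln C - kappa * x))%:E).
  by rewrite EFinM lee_wpmul2l// lee_fin invr_ge0 ltW.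
rewrite lee_fin mulrBr mulrCA mulVf ?gt_eqF// mulr1.
have : `|ln C| / x < t + kappa.
  suff [] : 0 < x /\ `|ln C| / x < t + kappa by [].
  by near: x; apply: near_pinfty_ratio; lra.
have : x^-1 * ln C <= `|ln C| / x by rewrite mulrC ler_pM2r ?invr_gt0// ler_norm.
lra.
Unshelve. all: by end_near. Qed.

Lemma log_tail_lower (c theta t : R) : 0 < c -> t < - theta ->
  (forall x, 1 <= x -> ((c * expR (- theta * x))%:E <= q x)%E) ->
  \forall x \near +oo, (t%:E <= rate x)%E.
Proof.
move=> C0 kt H; near=> x.
have x1 : 1 <= x by near: x; apply: nbhs_pinfty_ge; rewrite num_real.
have x0 : 0 < x by rewrite (lt_le_trans ltr01).
have Ce0 : 0 < c * expR (- theta * x) by rewrite mulr_gt0// expR_gt0.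
have lq : ((ln c - theta * x)%:E <= lne (q x))%E.
  have -> : (ln c - theta * x)%:E = lne (c * expR (- theta * x))%:E.
    by rewrite lne_EFin// lnM ?posrE ?expR_gt0// expRK mulNr.
  by rewrite lee_lne ?H// in_itv/= leey andbT ?q_ge0// lee_fin ltW.
apply: (@le_trans _ _ (x^-1 * (ln c - theta * x))%:E); last first.
  by rewrite EFinM lee_wpmul2l// lee_fin invr_ge0 ltW.
rewrite lee_fin mulrBr mulrCA mulVf ?gt_eqF// mulr1.
have : `|ln c| / x < - theta - t.
  suff [] : 0 < x /\ `|ln c| / x < - theta - t by [].
  by near: x; apply: near_pinfty_ratio; lra.
have : - (x^-1 * ln c) <= `|ln c| / x by rewrite -mulrN mulrC ler_pM2r ?invr_gt0// -normrN ler_norm.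
lra.
Unshelve. all: by end_near. Qed.

Lemma cvge_squeeze_fin (f : R -> \bar R) (a : R) :
  (forall t, a < t -> \forall x \near +oo, (f x <= t%:E)%E) ->
  (forall t, t < a -> \forall x \near +oo, (t%:E <= f x)%E) ->
  f x @[x --> +oo] --> a%:E.
Proof.
move=> fu fl; apply/fine_cvgP.
have fin (e : R) : 0 < e -> \forall x \near +oo, f x \is a fin_num /\
    a - e <= fine (f x) <= a + e.
  move=> e0; near=> x.
  have u : (f x <= (a + e)%:E)%E by near: x; apply: fu; rewrite ltrDl.
  have l : ((a - e)%:E <= f x)%E by near: x; apply: fl; rewrite ltrBlDr ltrDl.
  by move: u l; case: (f x) => // z; rewrite !lee_fin => -> ->.
split; first by apply: filterS (fin 1 ltr01) => x [].
apply/cvgrPdist_le => e e0; apply: filterS (fin e e0) => x [_ /andP[l u]] /=.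
by rewrite ler_norml; apply/andP; split; lra.
Unshelve. all: by end_near. Qed.

End LogarithmicAsymptotics.

Lemma tail_cvg {d d' : measure_display} {T : measurableType d}
    {T' : measurableType d'} {R : realType} (P : probability T R)
    (Q : probability T' R) (V : nat -> {RV P >-> R}) (Y : {RV Q >-> R}) (x : R) :
  converges_in_law V Y -> {for x, continuous (cdf Y)} ->
  P [set w | x < V n w] @[n --> \oo] --> Q [set w | x < Y w].
Proof.
move=> VY cY; rewrite tail_cdf; under eq_cvg do rewrite tail_cdf.
apply: (@cvgeB _ _ _ _ (cst 1%E)); [|exact: cvg_cst|exact: VY].
by rewrite fin_num_adde_defr.
Qed.

(** * Both tail bounds under the assumptions on the queue *)

Section Queue.
Context {R : realType} {d : measure_display} {T : measurableType d}.
Variables (P : probability T R) (A B : nat -> {RV P >-> R}).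
Hypothesis A_ge0 : forall n w, 0 <= A n w.
Hypothesis B_ge0 : forall n w, 0 <= B n w.
Hypothesis A_same_law : forall n, same_law (A n) (A 0%N).
Hypothesis B_same_law : forall n, same_law (B n) (B 0%N).
Hypothesis AB_independent : mutually_independent
  (fun i : nat + nat => match i with inl n => A n | inr n => B n end).
Hypothesis rho_lt1 : ('E_P[B 0%N] / 'E_P[A 0%N] < 1)%E.
Hypothesis B_gt_A : (0 < P [set w | (A 0%N w < B 0%N w)%R])%E.
Hypothesis B_light : light_tailed (B 0%N).

Let EA_ge0 : (0 <= \int[P]_w (A 0%N w)%:E)%E.
Proof. by apply: integral_ge0 => w _; rewrite lee_fin. Qed.

Let EB_gt0 : (0 < \int[P]_w (B 0%N w)%:E)%E.
Proof.
apply: ge0_integral_gt0 => //; apply: (lt_le_trans B_gt_A).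
rewrite le_measure ?inE//; [exact: measurable_set_lt|exact: measurable_set_lt|].
by move=> w /=; exact: le_lt_trans.
Qed.

Let EB_fin : (\int[P]_w (B 0%N w)%:E < +oo)%E.
Proof.
have [s0 s00 /(_ (s0 / 2))] := B_light.
have s2 : 0 < s0 / 2 by rewrite divr_gt0.
rewrite gtr0_norm// ltr_pdivrMr// ltr_pMr// ltr1n => /(_ isT).
rewrite mgfE => H.
apply: (@le_lt_trans _ _ ((s0 / 2)^-1%:E * \int[P]_w (expR (s0 / 2 * B 0%N w))%:E)%E).
  rewrite -ge0_integralZl ?lee_fin ?invr_ge0 ?(ltW s2)//; last first.
    by apply/measurable_EFinP; exact: measurable_expRM.
  apply: ge0_le_integral => //.
  - by move=> w _; rewrite lee_fin.
  - exact/measurable_EFinP.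
  - apply: emeasurable_funM => //; apply/measurable_EFinP; exact: measurable_expRM.
  - move=> w _; rewrite -EFinM lee_fin -ler_pdivrMl ?invr_gt0// invrK.
    by rewrite (le_trans _ (expR_ge1Dx _))// lerDr.
by rewrite lte_mul_pinfty// lee_fin invr_ge0 ltW.
Qed.

(** With extended reals, $\mathbb{E}A=0$ would make the ratio infinite because $\mathbb{E}B>0$, and
    $\mathbb{E}A=+\infty$ is settled by $\mathbb{E}B<\infty$. *)
Lemma mean_service_lt : (\int[P]_w (B 0%N w)%:E < \int[P]_w (A 0%N w)%:E)%E.
Proof.
move: rho_lt1; rewrite !expectation_def.
move: EA_ge0 EB_gt0 EB_fin; case: (\int[P]_w (A 0%N w)%:E)%E => [a| |]//.
rewrite lee_fin le_eqVlt => /predU1P[<-|a0] b0 bfin.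
  by rewrite inve0 gt0_muley// ltNge leey.
by rewrite inver gt_eqF// lte_pdivrMr// mul1e.
Qed.

Lemma arrival_not_null : (P [set w | A 0%N w = 0%R] < 1)%E.
Proof.
rewrite lt_neqAle probability_le1 ?andbT; last exact: (@measurable_RV _ _ _ _ _ [set 0]).
apply/eqP => P1.
have mA0 : measurable [set w | A 0%N w = 0] by exact: (@measurable_RV _ _ _ _ _ [set 0]).
have : (\int[P]_w (A 0%N w)%:E = 0)%E.
  rewrite -(integral0 P setT); apply: ge0_ae_eq_integral => //.
  - exact/measurable_EFinP.
  - by move=> w _; rewrite lee_fin.
  have N0 : P (~` [set w | A 0%N w = 0]) = 0%E by rewrite probability_setC// P1 subee.
  exists (~` [set w | A 0%N w = 0]); split; [exact: measurableC|exact: N0|].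
  by move=> w /= H A0; apply: H => _; rewrite A0.
by move=> E; move: (lt_trans EB_gt0 mean_service_lt); rewrite E ltxx.
Qed.

Lemma A_indep_B (E F : set R) : measurable E -> measurable F ->
  P (A 0%N @^-1` E `&` B 0%N @^-1` F) = (P (A 0%N @^-1` E) * P (B 0%N @^-1` F))%E.
Proof.
move=> mE mF.
pose EF (i : nat + nat) := match i with inl _ => E | inr _ => F end.
have mEF i : measurable (EF i) by case: i.
have := @AB_independent [:: inl 0%N; inr 0%N] EF isT mEF.
rewrite !big_cons big_nil mule1 => <-; congr (P _); apply/seteqP; split.
  by move=> w [/= Aw Bw] i; rewrite !inE => /orP[] /eqP ->.
by move=> w H; split; [apply: (H (inl 0%N))|apply: (H (inr 0%N))]; rewrite !inE eqxx ?orbT.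
Qed.

Variable r : T -> nat -> R -> R.
Hypothesis r_srpt : {ae P, forall w, preemptive_srpt (A ^~ w) (B ^~ w) (r w)}.
Variable V : nat -> {RV P >-> R}.
Hypothesis V_sojourn : forall n,
  {ae P, forall w, (V n w)%:E = sojourn_time (A ^~ w) (r w) n}.

Let A0 := A_ge0 0%N.
Let B0 := B_ge0 0%N.

Lemma sojourn_upper kappa : 0 < kappa -> (kappa%:E < gamma_p (A 0%N) (B 0%N))%E ->
  exists C : R, forall n (x : R), 0 <= x ->
    (P [set w | (x < V n w)%R] <= (C * expR (- kappa * x))%:E)%E.
Proof.
move=> k0 /lt_gamma_p[s s0 Psis].
have [Bfin AB1] := Psi_lt_mgf A0 B0 arrival_not_null s0 Psis.
(* The tilt of the interarrival times is [s - kappa], so that the exponent of the upper bound comes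
   out as [kappa]. *)
have psi0 : 0 < s - kappa.
  by rewrite -lte_fin (le_lt_trans _ Psis)// Psi_ge0// arrival_not_null.
have Afin : 'M_P (A 0%N) (- (s - kappa)) \is a fin_num.
  by rewrite mgf_fin_num// oppr_le0 ltW.
have ps : s - kappa < s by rewrite ltrBlDr ltrDl.
have [C HC] := sojourn_tail_upper A_ge0 B_ge0 A_same_law B_same_law AB_independent
   r_srpt V_sojourn psi0 ps (esym (fineK Afin)) (esym (fineK Bfin))
   ltac:(by rewrite -lte_fin EFinM !fineK).
exists C => n x x0; have -> : - kappa = - (s - (s - kappa)) by ring.
exact: HC.
Qed.

Hypothesis B_endpoint : P [set w | (B 0%N w)%:E = right_endpoint (B 0%N)] = 0%E.

Lemma sojourn_lower theta : (gamma_p (A 0%N) (B 0%N) < theta%:E)%E ->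
  exists (c : R) (h : nat), 0 < c /\ forall n (x : R), (h <= n)%N -> 0 <= x ->
    ((c * expR (- theta * x))%:E <= P [set w | (x < V n w)%R])%E.
Proof.
move=> gt.
have th0 : 0 < theta.
  by rewrite -lte_fin (le_lt_trans _ gt)// gamma_p_ge0// arrival_not_null.
have mgf_gt1 s : 0 <= s -> (1 < 'M_P (A 0%N) (- (s - theta)) * 'M_P (B 0%N) s)%E.
  by move=> s0; apply: (Psi_gt_mgf A0 B0 arrival_not_null s0 (gamma_p_lt gt s0)).
have [k [mass drift [s1 s10 drift1]]] := dyadic_walk_spec A0 B0 B_endpoint th0 mgf_gt1
   A_indep_B B_gt_A mean_service_lt.
have clock0 (x : 'I_(4 ^ k) * 'I_(top_cell B0 k)) : 0 <= walk_clock x :> R.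
  by rewrite mulr_ge0// ltW// mesh_gt0.
have surv := survival_lower_bound (@walk_weight_ge0 _ _ _ P (A 0%N) (B 0%N) B0 k)
   (walk_weight_le1 A0 B0 k) clock0 th0 mass drift s10 drift1.
have [x [w0 j0]] : exists x : 'I_(4 ^ k) * 'I_(top_cell B0 k),
    0 < walk_weight (A 0%N) x /\ 0 < walk_jump x.
  apply: contrapT => no; move: drift1; rewrite ltNge => /negP; apply.
  apply: sumr_le0 => x _; have [j0|j0] := leP (walk_jump x) 0.
    by rewrite mulr_ge0_le0// mulr_ge0 ?expR_ge0// walk_weight_ge0.
  rewrite /tilted_weight (_ : walk_weight (A 0%N) x = 0) ?mul0r//.
  apply/eqP; rewrite eq_le walk_weight_ge0 andbT leNgt; apply/negP => w0.
  by apply: no; exists x.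
case: x w0 j0 => i0 j0' w0 j0.
have := (sojourn_tail_lower A_ge0 B_ge0 A_same_law B_same_law AB_independent r_srpt
  V_sojourn w0 j0 (top_cell_gt0 B0 k) surv); exact.
Qed.

End Queue.

(* V n is the sojourn time of customer n in the queue that starts empty;
   the steady-state sojourn time V_SRPT is the limit in law of V n. *)
Theorem theorem4p1
  (R : realType)
  (d : measure_display) (T : measurableType d) (P : probability T R)
  (A B : nat -> {RV P >-> R})
  (A_ge0 : forall n w, 0 <= A n w)
  (B_ge0 : forall n w, 0 <= B n w)
  (A_same_law : forall n, same_law (A n) (A 0%N))
  (B_same_law : forall n, same_law (B n) (B 0%N))
  (AB_independent : mutually_independent
     (fun i : nat + nat => match i with inl n => A n | inr n => B n end))
  (rho_lt1 : ('E_P[B 0%N] / 'E_P[A 0%N] < 1)%E)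
  (B_gt_A : (0 < P [set w | (A 0%N w < B 0%N w)%R])%E)
  (B_light : light_tailed (B 0%N))
  (B_endpoint : P [set w | (B 0%N w)%:E = right_endpoint (B 0%N)] = 0%E)
  (r : T -> nat -> R -> R)
  (r_srpt : {ae P, forall w, preemptive_srpt (A ^~ w) (B ^~ w) (r w)})
  (V : nat -> {RV P >-> R})
  (V_sojourn : forall n,
     {ae P, forall w, (V n w)%:E = sojourn_time (A ^~ w) (r w) n})
  (d' : measure_display) (T' : measurableType d') (Q : probability T' R)
  (V_SRPT : {RV Q >-> R})
  (V_SRPT_steady : converges_in_law V V_SRPT) :
  ((x^-1)%:E * lne (Q [set w | (x < V_SRPT w)%R]))%E @[x --> +oo%R] -->
    (- gamma_p (A 0%N) (B 0%N))%E.
Proof.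
have mono (x y : R) : x <= y ->
    (Q [set w | (y < V_SRPT w)%R] <= Q [set w | (x < V_SRPT w)%R])%E.
  move=> xy; apply: le_measure; rewrite ?inE; [exact: measurable_set_lt|exact: measurable_set_lt|].
  by move=> w /=; exact: le_lt_trans.
pose q x := Q [set w | (x < V_SRPT w)%R].
have q_ge0 x : (0 <= q x)%E by exact: measure_ge0.
have g0 : (0 <= gamma_p (A 0%N) (B 0%N))%E.
  apply: gamma_p_ge0 => //.
  exact: (arrival_not_null A_ge0 B_ge0 rho_lt1 B_gt_A B_light).
have upper kappa t : 0 < kappa -> (kappa%:E < gamma_p (A 0%N) (B 0%N))%E -> - kappa < t ->
    \forall x \near +oo, ((x^-1)%:E * lne (q x) <= t%:E)%E.
  move=> k0 kg kt.
  have [C HC] := sojourn_upper A_ge0 B_ge0 A_same_law B_same_law AB_independent rho_lt1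
    B_gt_A B_light r_srpt V_sojourn k0 kg.
  have C1 : 0 < (`|C| + 1) * expR kappa by rewrite mulr_gt0 ?expR_gt0// ltr_wpDl.
  apply: (log_tail_upper q_ge0 C1 kt) => x x1.
  (* A continuity point within distance 1 below [x]; the shift costs at most the factor
     [expR kappa]. *)
  have [|x' [xx' x'x cx']] := @cdf_continuity_point _ _ _ Q V_SRPT (x - 1) x.
    by rewrite ltrBlDr ltrDl.
  have x'0 : 0 <= x' by rewrite (le_trans _ (ltW xx'))// subr_ge0.
  apply: (le_trans (mono _ _ (ltW x'x))).
  have cv := tail_cvg V_SRPT_steady cx'.
  rewrite -(cvg_lim (@ereal_hausdorff R) cv); apply: lime_le; first by apply/cvg_ex; exists (q x').
  apply: nearW => n; apply: (le_trans (HC n x' x'0)); rewrite lee_fin.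
  apply: (@le_trans _ _ ((`|C| + 1) * expR (- kappa * x'))).
    by rewrite ler_wpM2r ?expR_ge0// (le_trans (ler_norm C))// lerDl.
  by rewrite -mulrA -expRD ler_wpM2l ?addr_ge0// ler_expR; nra.
have lower theta t : (gamma_p (A 0%N) (B 0%N) < theta%:E)%E -> t < - theta ->
    \forall x \near +oo, (t%:E <= (x^-1)%:E * lne (q x))%E.
  move=> kg kt.
  have [c [h [c0 HC]]] := sojourn_lower A_ge0 B_ge0 A_same_law B_same_law AB_independent
    rho_lt1 B_gt_A B_light r_srpt V_sojourn B_endpoint kg.
  have th0 : 0 <= theta by rewrite -lee_fin ltW// (le_lt_trans g0 kg).
  have c1 : 0 < c * expR (- theta) by rewrite mulr_gt0 ?expR_gt0.
  apply: (log_tail_lower q_ge0 c1 kt) => x x1.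
  have [|x' [xx' x'x cx']] := @cdf_continuity_point _ _ _ Q V_SRPT x (x + 1).
    by rewrite ltrDl.
  have x'0 : 0 <= x' by rewrite (le_trans _ (ltW xx'))// (le_trans ler01).
  apply: (le_trans _ (mono _ _ (ltW xx'))).
  have cv := tail_cvg V_SRPT_steady cx'.
  rewrite -(cvg_lim (@ereal_hausdorff R) cv); apply: lime_ge; first by apply/cvg_ex; exists (q x').
  exists h => // n hn; apply: (le_trans _ (HC n x' hn x'0)); rewrite lee_fin.
  rewrite -mulrA -expRD ler_wpM2l ?(ltW c0)// ler_expR; nra.
move: g0 upper lower; case: (gamma_p _ _) => [g| |]// g0 upper lower.
(* In both directions [(g - t) / 2] is the midpoint of [g] and [- t]. For [0 <= t] the upper bound
   is just that probabilities are at most 1; this covers [g = 0], where no [kappa > 0] is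
   available. *)
- rewrite -EFinN; apply: cvge_squeeze_fin => t tg; last first.
    by apply: (@lower ((g - t) / 2) t); rewrite ?lte_fin; lra.
  have [t0|t0] := leP 0 t.
    near=> x; apply: (@le_trans _ _ 0%E); last by rewrite lee_fin.
    rewrite mule_ge0_le0 ?lee_fin//.
      by rewrite invr_ge0; near: x; apply: nbhs_pinfty_ge; rewrite num_real.
    by rewrite lne_le0 probability_le1//; exact: measurable_set_lt.
  by apply: (@upper ((g - t) / 2)); rewrite ?lte_fin; rewrite lee_fin in g0; lra.
(* With an infinite decay rate the upper bound alone suffices, for any positive [kappa] beyond
   [- t]. *)
- apply/cvgeNyPle => t; apply: (@upper (`|t| + 1)); rewrite ?ltry//.
  have := ler_norm (- t); rewrite normrN; lra.
Unshelve. all: by end_near. Qed.
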